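(* Let $c\in\mathcal{C}^1(\mathbb{R}^d\times\mathbb{R}^d)$. Let $\rho$ and $\mu$ be Borel probability measures on $\mathbb{R}^d$ with bounded support. Assume that $(A_i)_{i\in I}$ and $(B_j)_{j\in J}$ are families of measurable, rectifiably connected sets such that $$\operatorname{spt}\rho=\bigcup_{i\in I}A_i\quad\text{and}\quad \operatorname{spt}\mu=\bigcup_{j\in J}B_j.$$ Then solutions to the dual optimal transport problem $$\max_{\substack{(\phi,\psi)\in L^1(\rho)\times L^1(\mu)\\ \phi\oplus\psi\le c}}\int_{\mathbb{R}^d}\phi\,\mathrm{d}\rho+\int_{\mathbb{R}^d}\psi\,\mathrm{d}\mu$$ exist, and they are unique up to a constant $\rho$- and $\mu$-a.e. (that is, for any two optimisers $(\phi_0,\psi_0)$, $(\phi_1,\psi_1)$ there is $l\in\mathbb{R}$ with $\phi_0-\phi_1=l$ $\rho$-a.e. and $\psi_0-\psi_1=-l$ $\mu$-a.e.) if the following bipartite graph $G=(V,E)$ is connected: (i) $V=(A_i)_{i\in I}\cup(B_j)_{j\in J}$ (the $A_i$ forming one side and the $B_j$ the other); (ii) $(A_i,B_j)\in E$ if and only if there exists $\gamma\in\Pi(\rho,\mu)$ optimal for $\min_{\gamma\in\Pi(\rho,\mu)}\int c\,\mathrm{d}\gamma$ with $\gamma(A_i\times B_j)>0$.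
   Context: $\operatorname{spt}$ denotes the support of a measure, and $\Pi(\rho,\mu)$ the set of couplings, i.e. probability measures on $\mathbb{R}^d\times\mathbb{R}^d$ with first marginal $\rho$ and second marginal $\mu$. A set $\Omega\subseteq\mathbb{R}^d$ is rectifiably connected if for any $x,x'\in\Omega$ there exists $\omega\in W^{1,1}([0,1];\Omega)$ (an absolutely continuous curve with values in $\Omega$) with $\omega(0)=x'$ and $\omega(1)=x$. In the dual problem, potentials are pointwise defined measurable functions $\phi,\psi:\mathbb{R}^d\to\mathbb{R}\cup\{-\infty\}$ that are integrable with respect to $\rho$, respectively $\mu$; the constraint $\phi\oplus\psi\le c$ means $\phi(x)+\psi(y)\le c(x,y)$ for all $(x,y)\in\mathbb{R}^d\times\mathbb{R}^d$. *)

(* Defs.v *)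
From HB Require Import structures.
From mathcomp Require Import all_boot all_order all_algebra.
From mathcomp Require Import all_classical all_reals all_analysis.
From Stdlib Require Import Relation_Operators.

Set Implicit Arguments.
Unset Strict Implicit.
Unset Printing Implicit Defensive.

Import Order.TTheory GRing.Theory Num.Theory.
Import numFieldNormedType.Exports.

Local Open Scope classical_set_scope.
Local Open Scope ring_scope.

(* R^d is 'rV[R]_d, normed by the sup norm.  MathComp-Analysis puts no
   sigma-algebra on matrices; we equip them with the Borel one.  The library's
   product sigma-algebra on 'rV[R]_d * 'rV[R]_d is then the Borel sigma-algebra
   of the product, since 'rV[R]_d is second countable. *)
HB.instance Definition _ (R : realType) (m n : nat) :=
  @isMeasurable.Build (sigma_display (@open 'M[R]_(m, n))) 'M[R]_(m, n)
    <<s @open 'M[R]_(m, n) >>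
    (@sigma_algebra0 _ _ _) (@sigma_algebraC _ _) (@sigma_algebra_bigcup _ _ _).

Section analysis.
Variable R : realType.

Definition C1 (V W : normedModType R) (f : V -> W) : Prop :=
  (forall x, differentiable f x) /\
  (forall x (e : R), 0 < e ->
     \forall y \near x, forall v, `|'d f y v - 'd f x v| <= e * `|v|).

Definition abs_continuous (V : normedModType R) (a b : R) (f : R -> V) : Prop :=
  forall e : R, 0 < e -> exists2 delta : R, 0 < delta &
    forall (n : nat) (s t : 'I_n -> R),
      (forall i, [/\ a <= s i, s i <= t i & t i <= b]) ->
      trivIset setT (fun i => `]s i, t i[%classic) ->
      \sum_(i < n) (t i - s i) < delta ->
      \sum_(i < n) `|f (t i) - f (s i)| < e.

(* In dimension one, W^{1,1} curves are the absolutely continuous ones. *)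
Definition rectifiably_connected (V : normedModType R) (Omega : set V) : Prop :=
  forall x x', Omega x -> Omega x' ->
    exists omega : R -> V,
      [/\ abs_continuous 0 1 omega,
          (forall t, 0 <= t <= 1 -> Omega (omega t)),
          omega 0 = x' & omega 1 = x].

Definition spt (T : topologicalType) (mu : set T -> \bar R) : set T :=
  [set x | forall U, open U -> U x -> (0 < mu U)%E].

End analysis.

Section transport.
Variables (R : realType) (d : nat).
Local Notation X := 'rV[R]_d.
Variables (c : X * X -> R) (rho mu : probability X R).

Definition coupling (gamma : probability (X * X)%type R) : Prop :=
  (forall A : set X, measurable A -> gamma (fst @^-1` A) = rho A) /\
  (forall B : set X, measurable B -> gamma (snd @^-1` B) = mu B).

Definition optimal_plan (gamma : probability (X * X)%type R) : Prop :=
  coupling gamma /\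
  forall gamma' : probability (X * X)%type R, coupling gamma' ->
    (\int[gamma]_z (c z)%:E <= \int[gamma']_z (c z)%:E)%E.

Definition potential (nu : probability X R) (phi : X -> \bar R) : Prop :=
  (forall x, phi x != +oo%E) /\ nu.-integrable setT phi.

Definition dual_feasible (phi psi : X -> \bar R) : Prop :=
  [/\ potential rho phi, potential mu psi &
      forall x y, (phi x + psi y <= (c (x, y))%:E)%E].

Definition dual_value (phi psi : X -> \bar R) : \bar R :=
  (\int[rho]_x phi x + \int[mu]_y psi y)%E.

Definition dual_optimal (phi psi : X -> \bar R) : Prop :=
  dual_feasible phi psi /\
  forall phi' psi', dual_feasible phi' psi' ->
    (dual_value phi' psi' <= dual_value phi psi)%E.

(* Vertices are indices, so that the two sides stay disjoint even when some
   A i and B j are the same set. *)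
Definition ot_adj (I J : Type) (A : I -> set X) (B : J -> set X)
    (u v : I + J) : Prop :=
  match u, v with
  | inl i, inr j | inr j, inl i =>
      exists gamma, optimal_plan gamma /\ (0 < gamma (A i `*` B j))%E
  | _, _ => False
  end.

End transport.

Definition graph_connected (V : Type) (adj : V -> V -> Prop) : Prop :=
  forall u v, clos_refl_trans V adj u v.

(* Main.v *)
(* Write K = spt rho and L = spt mu, both compact, and replace c by a bounded
   globally Lipschitz cost k that agrees with c on K x L (precompose c with the
   coordinatewise truncation to a large box).

   Replacing a feasible pair by its double c-transform with respect to k, K
   and L does not decrease the dual value and yields uniformly bounded,
   uniformly Lipschitz potentials, so that a maximising sequence converges
   uniformly on K and L along an ultrafilter.

   If gamma is an optimal plan, cyclically exchanging small pieces of mass of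
   gamma shows that spt gamma is c-cyclically monotone, and Rockafellar's
   construction gives a feasible pair whose value is the cost of gamma.  Hence
   every optimal pair (f, g) satisfies f x + g y = c (x, y) on spt gamma, and x
   minimises c (., y) - f over K there.  Along a rectifiable curve,
   reparametrised to be Lipschitz, two such potentials f0 and f1 are almost
   everywhere differentiable, and at a point x of the curve both derivatives
   equal that of c (., y) for the same y with (x, y) in spt gamma.  So f0 - f1
   is constant on each A i, likewise g0 - g1 on each B j, and an edge
   (A i, B j) makes these constants opposite.  Working with the continuous
   potentials, for which the equalities hold at every point, avoids taking an
   uncountable union of null sets when I or J is uncountable. *)

Require Import Defs.
From HB Require Import structures.
From mathcomp Require Import all_boot all_order all_algebra.
From mathcomp Require Import all_classical all_reals all_analysis.
From mathcomp Require Import measurable_realfun ring lra.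
From Stdlib Require Import Relation_Operators.

Set Implicit Arguments.
Unset Strict Implicit.
Unset Printing Implicit Defensive.

Import Order.TTheory GRing.Theory Num.Theory.
Import numFieldNormedType.Exports.

Local Open Scope classical_set_scope.
Local Open Scope ring_scope.

(** * Borel sets and supports *)

(** Balls with rational centre and radius [1/(n+1)] form a base. If the radius is below [e / 2] and
    the ball contains [x], the triangle inequality places it in the [e]-ball of [x]. *)
Lemma rV_second_countable (R : realType) d : @second_countable 'rV[R]_d.
Proof.
pose b (p : 'rV[rat]_d * nat) : set 'rV[R]_d :=
  ball (map_mx (@ratr R) p.1) (p.2.+1%:R^-1).
exists (range b).
  by apply: sub_countable (card_image_le _ _) _; exact: countableP.
split; first by move=> _ [p _ <-]; exact: ball_open.
move=> x V /nbhs_ballP[e /= e0 eV].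
have [n ne] : exists n, (n.+1%:R^-1 : R) < e / 2.
  have e20 : 0 < e / 2 by rewrite divr_gt0.
  have [n _ /(_ n (leqnn n))] := near_infty_natSinv_lt (PosNum e20).
  by exists n.
have n0 : 0 < n.+1%:R^-1 :> R by rewrite invr_gt0.
have /choice[q qP] : forall j : 'I_d,
    exists q : rat, `|x 0 j - ratr q| < n.+1%:R^-1.
  move=> j; have lt1 : x 0 j - n.+1%:R^-1 < x 0 j + n.+1%:R^-1.
    by rewrite ltrD2l gtrN.
  have [q q12] := rat_in_itvoo lt1.
  by exists q; move: q12; rewrite in_itv/= ltr_distlC.
pose p : 'rV[rat]_d * nat := (\row_j q j, n).
have xB : ball (map_mx (@ratr R) p.1) n.+1%:R^-1 x.
  by split => // i j; rewrite ord1 !mxE /ball /= distrC; exact: qP.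
exists (b p); first by split => //; exists p.
move=> y yB; apply: eV; apply: le_ball (ball_triangle (ball_sym xB) yB).
by apply/ltW; rewrite [ltRHS]splitr ltrD.
Qed.

Lemma second_countable_seq (T : topologicalType) : @second_countable T ->
  exists b : nat -> set T, (forall n, open (b n)) /\
    forall x U, nbhs x U -> exists n, b n x /\ b n `<=` U.
Proof.
move=> [B /countable_injP[f finj] [Bo Bb]].
exists (fun n => \bigcup_(V in [set V | B V /\ f V = n]) V); split.
  by move=> n; apply: bigcup_open => V [BV _]; exact: Bo.
move=> x U xU; have [V [BV Vx] VU] := Bb x _ xU.
exists (f V); split; first by exists V.
by move=> y [W [BW fWV] Wy]; apply: VU; rewrite -(finj _ _ _ _ fWV)// inE.
Qed.

Lemma open_rV_measurable (R : realType) d (U : set 'rV[R]_d) :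
  open U -> measurable U.
Proof. by move=> oU; exact: sub_gen_smallest. Qed.

Lemma second_countable_prod (T1 T2 : topologicalType) :
  @second_countable T1 -> @second_countable T2 -> @second_countable (T1 * T2)%type.
Proof.
move=> /second_countable_seq[b [bo bb]] /second_countable_seq[c [co cc]].
exists (range (fun p : nat * nat => b p.1 `*` c p.2)).
  by apply: sub_countable (card_image_le _ _) _; exact: countableP.
split.
  move=> _ [[n m] _ <-]; rewrite openE => z [/= z1 z2].
  exists (b n, c m); last by move=> w.
  by split; apply: open_nbhs_nbhs; split => //; [exact: bo|exact: co].
move=> [x y] U [[P Q] [/= xP yQ] PQU].
have [n [bnx bnP]] := bb _ _ xP.
have [m [cmy cmQ]] := cc _ _ yQ.
exists (b n `*` c m); first by split => //; exists (n, m).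
by apply: subset_trans PQU => z [/bnP + /cmQ].
Qed.

(** Here topology and product sigma-algebra meet: an open set is the union of the open rectangles
    from a countable family that it contains. *)
Lemma open_rV2_measurable (R : realType) d (U : set ('rV[R]_d * 'rV[R]_d)) :
  open U -> measurable U.
Proof.
move=> oU; have [b [bo bb]] := second_countable_seq (@rV_second_countable R d).
pose D : set (nat * nat) := [set p | b p.1 `*` b p.2 `<=` U].
suff -> : U = \bigcup_(p in D) (b p.1 `*` b p.2).
  rewrite bigcup_mkcond; apply: countable_bigcupT_measurable.
    exact: countableP.
  move=> p; case: ifP => _ //.
  by apply: measurableX; apply: open_rV_measurable; exact: bo.
apply/seteqP; split => [z Uz|z [p Dp]]; last exact: Dp.
have [[P Q] [/= zP zQ] PQU] : nbhs z U by exact: open_nbhs_nbhs.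
have [n [bnz bnP]] := bb _ _ zP.
have [m [bmz bmQ]] := bb _ _ zQ.
by exists (n, m) => //; apply: subset_trans PQU => y [/bnP + /bmQ].
Qed.

Lemma closed_rV_measurable (R : realType) d (K : set 'rV[R]_d) :
  closed K -> measurable K.
Proof.
by move=> cK; rewrite -(setCK K); apply: measurableC; apply: open_rV_measurable;
  exact: closed_openC.
Qed.

Lemma closed_spt (T : topologicalType) (R : realType) (mu : set T -> \bar R) :
  closed (spt mu).
Proof.
move=> x clx U oU Ux.
have [y [sy Uy]] := clx U (open_nbhs_nbhs (conj oU Ux)).
exact: sy.
Qed.

(** A point outside the support has a null neighbourhood, hence a null basic one, and there are
    countably many of these. Only open sets occur in the hypotheses, so that the lemma serves both
    for the Borel structure on vectors and for the product structure on pairs. *)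
Lemma spt_setC_null (T : topologicalType) (R : realType) (mu : set T -> \bar R) :
  @second_countable T -> mu set0 = 0%E ->
  (forall U, open U -> (0 <= mu U)%E) ->
  (forall U V, open U -> open V -> U `<=` V -> (mu U <= mu V)%E) ->
  (forall F : nat -> set T, (forall n, open (F n)) ->
     (forall n, mu (F n) = 0%E) -> mu (\bigcup_n F n) = 0%E) ->
  mu (~` spt mu) = 0%E.
Proof.
move=> /second_countable_seq[b [bo bb]] mu0 mu_ge0 mu_le mu_null.
pose F n := if mu (b n) == 0%E then b n else set0.
suff -> : ~` spt mu = \bigcup_n F n.
  apply: mu_null => n; rewrite /F; first by case: ifP => _ //; exact: open0.
  by case: ifPn => // /eqP.
apply/seteqP; split => [x|x [n _]].
  move=> /existsNP[U /not_implyP[oU /not_implyP[Ux /negP]]].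
  rewrite -leNgt => U0.
  have [n [bx bU]] := bb _ _ (open_nbhs_nbhs (conj oU Ux)).
  exists n => //; rewrite /F ifT//.
  by rewrite eq_le mu_ge0// andbT (le_trans _ U0)// mu_le.
rewrite /F; case: ifPn => // /eqP bn0 bx /(_ _ (bo n) bx).
by rewrite bn0 ltxx.
Qed.

Section rV_measure.
Context (R : realType) (d : nat).
Local Notation X := 'rV[R]_d.

Lemma rV_spt_setC_null (mu : {measure set X -> \bar R}) : mu (~` spt mu) = 0%E.
Proof.
apply: spt_setC_null => //; first exact: rV_second_countable.
- by move=> U V oU oV UV; rewrite le_measure// inE; exact: open_rV_measurable.
- move=> F oF F0; have mF n : measurable (F n) by exact: open_rV_measurable.
  apply/negligibleP; first exact: bigcup_measurable.
  apply: negligible_bigcup => n; apply/negligibleP; [exact: mF|exact: F0].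
Qed.

Lemma rV2_spt_setC_null (mu : {measure set (X * X)%type -> \bar R}) :
  mu (~` spt mu) = 0%E.
Proof.
apply: spt_setC_null => //; first by apply: second_countable_prod; exact: rV_second_countable.
- by move=> U V oU oV UV; rewrite le_measure// inE; exact: open_rV2_measurable.
- move=> F oF F0; have mF n : measurable (F n) by exact: open_rV2_measurable.
  apply/negligibleP; first exact: bigcup_measurable.
  apply: negligible_bigcup => n; apply/negligibleP; [exact: mF|exact: F0].
Qed.

Lemma continuous_rV_measurable (f : X -> R) :
  continuous f -> measurable_fun setT f.
Proof.
move=> cf; apply: (measurability _ (RGenOInfty.measurableE R)) => //.
move=> _ [_ [a ->] <-]; rewrite setTI; apply: open_rV_measurable.
by apply: open_comp => [x _|]; [exact: cf|exact: rray_open].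
Qed.

Lemma continuous_rV2_measurable (f : X * X -> R) :
  continuous f -> measurable_fun setT f.
Proof.
move=> cf; apply: (measurability _ (RGenOInfty.measurableE R)) => //.
move=> _ [_ [a ->] <-]; rewrite setTI; apply: open_rV2_measurable.
by apply: open_comp => [x _|]; [exact: cf|exact: rray_open].
Qed.

End rV_measure.

(** * Lipschitz regularisation of the cost *)

Lemma lipschitz_is_continuous (R : realType) (V : normedModType R) (f : V -> R) C :
  (forall x x', `|f x - f x'| <= C * `|x - x'|) -> continuous f.
Proof.
move=> lf x; apply/(@cvgrPdist_le _ R^o) => e e0.
(* [C] may be zero or negative, while a positive number is needed to divide by. *)
have C1 : 0 < `|C| + 1 by rewrite ltr_wpDl.
near=> s; apply: le_trans (lf _ _) _.
apply: (@le_trans _ _ ((`|C| + 1) * `|x - s|)).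
  by rewrite ler_wpM2r// (le_trans (ler_norm C))// lerDl.
rewrite -ler_pdivlMl//; near: s; apply: cvgr_dist_le => //.
by rewrite mulr_gt0// invr_gt0.
Unshelve. all: by end_near. Qed.

Section C1_lipschitz.
Context (R : realType) (V : normedModType R).

(** Nearness in [x'] and [C] jointly is the form that [compact_near_coveringP] turns into one bound
    valid on a whole compact set. *)
Lemma C1_locally_bounded (f : V -> R) (x : V) : C1 f ->
  \forall x' \near x & C \near +oo, forall v, `|'d f x' v| <= C * `|v|.
Proof.
move=> [df cdf].
have /linear_boundedP : bounded_near ('d f x) (nbhs 0).
  by apply: continuous_linear_bounded; apply: diff_continuous; exact: df.
case=> M [Mr HM]; pose C0 := Num.max M 0 + 1 + 1.
exists ([set x' | forall v, `|'d f x' v - 'd f x v| <= 1 * `|v|],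
        [set C | C0 <= C]); first split => /=.
- exact: cdf.
- exact: nbhs_pinfty_ge (num_real _).
move=> [x' C] /= [Hx' HC] v.
rewrite -(subrK ('d f x v) ('d f x' v)).
apply: le_trans (ler_normD _ _) _.
have : `|'d f x v| <= (Num.max M 0 + 1) * `|v|.
  by apply: HM; rewrite ltr_pwDr// le_max lexx.
move=> /(lerD (Hx' v)) /le_trans; apply.
by rewrite addrC -mulrDl ler_wpM2r.
Qed.

(** Compactness bounds the differential on [K], and the mean value theorem is applied along the
    segment from [x] to [y], which stays in [K] by convexity. *)
Lemma C1_lipschitz (f : V -> R) (K : set V) : C1 f -> compact K ->
  (forall x y t, K x -> K y -> 0 <= t <= 1 -> K (x + t *: (y - x))) ->
  exists2 C, 0 <= C & forall x y, K x -> K y -> `|f x - f y| <= C * `|x - y|.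
Proof.
move=> fC1 cK convK.
have [C C0 KC] : exists2 C, 0 <= C &
    forall x, K x -> forall v, `|'d f x v| <= C * `|v|.
  have /compact_near_coveringP cov := cK.
  have := @cov R +oo (fun C x => forall v, `|'d f x v| <= C * `|v|) _
    (fun x _ => C1_locally_bounded x fC1).
  case=> C [Cr HC]; exists (Num.max C 0 + 1).
    by rewrite addr_ge0// le_max lexx orbT.
  by move=> x Kx v; apply: HC => //; rewrite ltr_pwDr// le_max lexx.
exists C => // y x Ky Kx.
pose g (t : R) := f (x + t *: (y - x)).
have dg (t : R) : is_derive t (1 : R) g ('d f (x + t *: (y - x)) (y - x)).
  have [df _] := fC1.
  have dq : (fun h : R => h^-1 *: ((g \o shift t) (h *: 1) - g t)) =
      (fun h : R => h^-1 *: ((f \o shift (x + t *: (y - x))) (h *: (y - x)) -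
                             f (x + t *: (y - x)))).
    apply/funext => h; rewrite /g /=; congr (_ *: (f _ - _)).
    by rewrite [h *: 1]mulr1 scalerDl addrCA.
  split; rewrite /derivable /derive dq; first exact: diff_derivable.
  exact: deriveE (df _).
have [|t t01] := @MVT_segment _ g _ 0 1 ler01 (fun t _ => dg t).
  by apply: derivable_within_continuous => t _; have [] := dg t.
rewrite /g scale1r scale0r addr0 addrCA subrr addr0 subr0 mulr1 => ->.
by apply: KC; apply: convK => //; move: t01; rewrite in_itv.
Qed.
End C1_lipschitz.

Lemma maxmin_lipschitz (R : realDomainType) (x y s t : R) :
  `|Num.max x (Num.min s y) - Num.max x (Num.min t y)| <= `|s - t|.
Proof.
rewrite /Num.max /Num.min; do ![case: ifPn]; rewrite -?leNgt => *.
all: rewrite ler_norml; have := ler_norm (s - t);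
  have := ler_norm (t - s); rewrite (distrC t) => ? ?; apply/andP; split; lra.
Qed.

Section clamp.
Context (R : realType) (d : nat).
Local Notation X := 'rV[R]_d.

Lemma rV_norm_le (x : X) (e : R) : 0 <= e ->
  (`|x| <= e) <-> (forall j, `|x 0 j| <= e).
Proof.
move=> e0; rewrite [`|x|]/Num.Def.normr/= mx_normrE; split.
  move=> xe j; apply: le_trans xe.
  exact: (le_bigmax _ (fun ij : 'I_1 * 'I_d => `|x ij.1 ij.2|) (0, j)).
by move=> xe; apply/bigmax_leP; split => // -[i j] _; rewrite ord1.
Qed.

(** For [r >= 0] this is a 1-Lipschitz retraction onto the closed ball of radius [r] of the sup
    norm. *)
Definition clamp (r : R) (x : X) : X :=
  \row_j Num.max (- r) (Num.min (x 0 j) r).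

Lemma clamp_norm r x : 0 <= r -> `|clamp r x| <= r.
Proof.
move=> r0; apply/rV_norm_le => // j; rewrite mxE ler_norml le_max lexx/=.
by rewrite ge_max ge_min lexx orbT andbT (le_trans _ r0)// oppr_le0.
Qed.

Lemma clamp_id r x : `|x| <= r -> clamp r x = x.
Proof.
move=> xr; have r0 : 0 <= r by rewrite (le_trans _ xr).
move/(rV_norm_le _ r0) : xr => xr; apply/rowP => j; rewrite mxE.
by have := xr j; rewrite ler_norml => /andP[? ?]; rewrite min_l// max_r.
Qed.

Lemma clamp_lipschitz r x y : `|clamp r x - clamp r y| <= `|x - y|.
Proof.
apply/rV_norm_le => // j; rewrite !mxE.
have /rV_norm_le - /(_ (normr_ge0 _) j) := lexx `|x - y|; rewrite !mxE.
apply: le_trans.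
exact: maxmin_lipschitz.
Qed.
End clamp.

Section regularized_cost.
Context (R : realType).

Definition lipschitz_cost (U V : normedModType R) (C M : R) (k : U -> V -> R) :=
  [/\ 0 <= C, 0 <= M,
      forall x y, `|k x y| <= M,
      forall x x' y, `|k x y - k x' y| <= C * `|x - x'| &
      forall x y y', `|k x y - k x y'| <= C * `|y - y'|].

Lemma regularized_cost d (c : 'rV[R]_d * 'rV[R]_d -> R) (K L : set 'rV[R]_d) :
  C1 c -> bounded_set K -> bounded_set L ->
  exists (k : 'rV[R]_d -> 'rV[R]_d -> R) (C M : R),
    lipschitz_cost C M k /\ forall x y, K x -> L y -> k x y = c (x, y).
Proof.
move=> cC1 [M1 [_ HK]] [M2 [_ HL]].
(* Boundedness gives the estimate [|x| <= s] only for [s] strictly above [M1] or [M2], whence the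
   [+ 1]. *)
pose r := Num.max (Num.max M1 M2) 0 + 1.
have r0 : 0 <= r by rewrite addr_ge0// le_max lexx orbT.
have Kr x : K x -> `|x| <= r.
  by move=> Kx; apply: HK => //; rewrite ltr_pwDr// !le_max lexx.
have Lr x : L x -> `|x| <= r.
  by move=> Kx; apply: HL => //; rewrite ltr_pwDr// !le_max lexx orbT.
pose B := [set x : 'rV[R]_d | `|x| <= r].
have cB : compact B.
  apply: bounded_closed_compact.
    by exists r; split; [exact: num_real|move=> s rs x /le_trans; apply; exact: ltW].
  rewrite (_ : B = closed_ball_ Num.Def.normr 0 r); first exact: closed_closed_ball_.
  by apply/seteqP; split => x; rewrite /B /closed_ball_/= sub0r normrN.
have convB (x y : 'rV[R]_d) t : B x -> B y -> 0 <= t <= 1 -> B (x + t *: (y - x)).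
  move=> Bx By /andP[t0 t1]; rewrite /B/=.
  have -> : x + t *: (y - x) = (1 - t) *: x + t *: y.
    by rewrite scalerBr scalerBl scale1r addrA addrAC.
  apply: le_trans (ler_normD _ _) _; rewrite !normrZ.
  rewrite (ger0_norm t0) ger0_norm ?subr_ge0//.
  move: Bx By; rewrite /B/= => Bx By; nra.
have cBB : compact (B `*` B) by exact: compact_setX.
have [|C C0 HC] := C1_lipschitz cC1 cBB.
  move=> x y t [Bx1 Bx2] [By1 By2] t01.
  by split; apply: convB.
pose k x y := c (clamp r x, clamp r y).
have Bc x : B (clamp r x) by exact: clamp_norm.
(* The bound on [k] compares a clamped pair with the origin, at distance at most [r]. *)
exists k, C, (`|c (0, 0)| + C * r); split; last first.
  by move=> x y Kx Ly; rewrite /k !clamp_id; [|exact: Lr|exact: Kr].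
have BB0 : (B `*` B) (0, 0) by split; rewrite /B/= normr0.
have BBc x y : (B `*` B) (clamp r x, clamp r y) by split; exact: Bc.
split => //.
- by rewrite addr_ge0// mulr_ge0.
- move=> x y; rewrite /k -[c (clamp r x, _)](subrK (c (0, 0))) addrC.
  apply: le_trans (ler_normD _ _) _; rewrite lerD2l.
  apply: le_trans (HC _ _ (BBc _ _) BB0) _; rewrite ler_wpM2l//.
  by rewrite prod_normE/= !subr0 ge_max; apply/andP; split; exact: Bc.
- move=> x x' y; apply: le_trans (HC _ _ (BBc _ _) (BBc _ _)) _; rewrite ler_wpM2l//.
  by rewrite prod_normE/= subrr normr0 ge_max clamp_lipschitz/=.
- move=> x y y'; apply: le_trans (HC _ _ (BBc _ _) (BBc _ _)) _; rewrite ler_wpM2l//.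
  by rewrite prod_normE/= subrr normr0 ge_max clamp_lipschitz/= andbT.
Qed.
End regularized_cost.

(** * Almost everywhere differentiability of Lipschitz functions *)

Section lipschitz_FTC.
Context (R : realType).
Local Notation leb := (@lebesgue_measure R).

Lemma lebesgue_stieltjes_itv (P : cumulative R R) (a b : R) : a <= b ->
  lebesgue_stieltjes_measure P `]a, b]%classic = (P b - P a)%:E.
Proof.
move=> ab.
rewrite /lebesgue_stieltjes_measure /measure_extension measurable_mu_extE/=.
  by rewrite wlength_itv_bnd// EFinB.
exact: is_ocitv.
Qed.

Lemma lipschitz_cumulative (P : R -> R) (C : R) :
  {homo P : s t / s <= t} -> (forall s t, `|P s - P t| <= C * `|s - t|) ->
  exists Pc : cumulative R R, Pc = P :> (R -> R).
Proof.
move=> ndP lP.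
have cP : continuous P := lipschitz_is_continuous lP.
have rcP : forall x, P @ at_right x --> P x by exact: right_continuousW.
pose Pc : cumulative R R := HB.pack P (isCumulative.Build R _ R P ndP rcP).
by exists Pc.
Qed.

(* The Stieltjes measures of P and Q add up to C times Lebesgue measure. *)
Lemma lipschitz_stieltjes_dominated (P Q T : cumulative R R) (C : R) :
  0 <= C -> (forall t, P t + Q t = C * t) -> T = (fun t => C * t) :> (R -> R) ->
  forall N, measurable N -> leb N = 0%E -> lebesgue_stieltjes_measure P N = 0%E.
Proof.
move=> C0 PQ TC N mN N0.
have eT X : ocitv X -> lebesgue_stieltjes_measure T X =
    mscale (NngNum C0) leb X.
  move=> [[u v] /= _ <-].
  have [uv|vu] := leP u v; last first.
    by rewrite set_itv_ge ?measure0// bnd_simp -leNgt ltW.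
  have lebE : leb `]u, v]%classic = (v - u)%:E by exact: lebesgue_stieltjes_itv.
  by rewrite lebesgue_stieltjes_itv// TC /mscale/= lebE -EFinM mulrBr.
have eT' X : ocitv X -> lebesgue_stieltjes_measure T X =
    measure_add (lebesgue_stieltjes_measure P) (lebesgue_stieltjes_measure Q) X.
  move=> [[u v] /= _ <-].
  have [uv|vu] := leP u v; last first.
    by rewrite set_itv_ge ?measure0// bnd_simp -leNgt ltW.
  rewrite measure_addE lebesgue_stieltjes_itv// TC.
  rewrite [X in _ = (X + _)%E]lebesgue_stieltjes_itv//.
  rewrite [X in _ = (_ + X)%E]lebesgue_stieltjes_itv// -EFinD.
  by rewrite -!PQ; congr EFin; ring.
have T0 : lebesgue_stieltjes_measure T N = 0%E.
  rewrite (lebesgue_stieltjes_measure_unique eT mN).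
  by rewrite -[LHS]/(C%:E * leb N)%E N0 mule0.
have TN : lebesgue_stieltjes_measure T N =
    (lebesgue_stieltjes_measure P N + lebesgue_stieltjes_measure Q N)%E.
  by rewrite (lebesgue_stieltjes_measure_unique eT' mN) -measure_addE.
by move: T0; rewrite TN => /eqP; rewrite padde_eq0// => /andP[/eqP].
Qed.

(** [D t + C * t] is nondecreasing, so it defines a Stieltjes measure. Together with that of
    [C * t - D t] it adds up to [2 * C] times Lebesgue measure, so it is absolutely continuous. Its
    Radon-Nikodym density is [g], and Lebesgue differentiation of the integral of [g] gives the
    derivative of [D]. *)
Lemma lipschitz_FTC (D : R -> R) (C a b : R) : 0 <= C ->
  (forall s t, `|D s - D t| <= C * `|s - t|) -> a < b ->
  exists g : R -> R, [/\ leb.-integrable setT (EFin \o g),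
    (forall t, a <= t <= b ->
       D t + C * t = D a + C * a + \int[leb]_(x in `]a, t]) g x) &
    {ae leb, forall t, a < t < b -> is_derive t (1 : R) D (g t - C)}].
Proof.
move=> C0 lD ab.
have [||P PE] := @lipschitz_cumulative (fun t => D t + C * t) (2 * C).
- move=> s t st; have := lD s t; rewrite ler_norml => /andP[_].
  by rewrite ler0_norm ?subr_le0//; nra.
- move=> s t; have -> : D s + C * s - (D t + C * t) = (D s - D t) + C * (s - t) by ring.
  apply: le_trans (ler_normD _ _) _.
  rewrite normrM (ger0_norm C0) (_ : 2 * C = C + C) ?mulrDl ?lerD2r; last by ring.
  exact: lD.
have [||Q QE] := @lipschitz_cumulative (fun t => C * t - D t) (2 * C).
- move=> s t st; have := lD s t; rewrite ler_norml => /andP[+ _].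
  by rewrite ler0_norm ?subr_le0//; nra.
- move=> s t; have -> : C * s - D s - (C * t - D t) = (D t - D s) + C * (s - t) by ring.
  apply: le_trans (ler_normD _ _) _.
  rewrite normrM (ger0_norm C0) (_ : 2 * C = C + C) ?mulrDl ?lerD2r; last by ring.
  rewrite distrC.
  exact: lD.
have C20 : 0 <= 2 * C by rewrite mulr_ge0.
have [||T TE] := @lipschitz_cumulative (fun t => (2 * C) * t) (2 * C).
- by move=> s t st; rewrite ler_wpM2l.
- by move=> s t; rewrite -mulrBr normrM ger0_norm.
have mab : measurable `]a, b]%classic by exact: measurable_itv.
pose nuP : {measure set (measurableTypeR R) -> \bar R} :=
  lebesgue_stieltjes_measure P.
have nuPE s t : s <= t -> nuP `]s, t]%classic = (P t - P s)%:E.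
  exact: lebesgue_stieltjes_itv.
have nuoo : (nuP `]a, b]%classic < +oo)%E.
  by rewrite nuPE ?ltry// ltW.
(* The restriction to []a, b]] makes the measure finite, hence a charge with an integrable
   density. *)
pose nu : {finite_measure set (measurableTypeR R) -> \bar R} :=
  @mfrestr _ (measurableTypeR R) _ _ nuP mab nuoo.
have numu : charge_of_finite_measure nu `<< leb.
  apply/null_content_dominatesP => N mN N0.
  rewrite /charge_of_finite_measure/= /mfrestr /mrestr.
  apply: (lipschitz_stieltjes_dominated (Q := Q) (T := T) C20) => //.
  - by move=> t; rewrite PE QE; ring.
  - exact: measurableI.
  - by apply: (subset_measure0 _ mN) => //; exact: measurableI.
pose f := Radon_Nikodym (charge_of_finite_measure nu) leb.
have intf : leb.-integrable setT f by exact: Radon_Nikodym_integrable.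
have finf x : f x \is a fin_num by exact: Radon_Nikodym_fin_num.
pose g := fine \o f.
have gE : EFin \o g = f by apply/funext => x; rewrite /= fineK.
have intg : leb.-integrable setT (EFin \o g) by rewrite gE.
have Pg t : a <= t <= b -> P t = P a + \int[leb]_(x in `]a, t]) g x.
  move=> /andP[at_ tb].
  have mat : measurable `]a, t]%classic by exact: measurable_itv.
  have := Radon_Nikodym_integral numu mat.
  rewrite /charge_of_finite_measure/= /mfrestr /mrestr.
  rewrite (_ : _ `&` _ = `]a, t]%classic); last first.
    by apply/setIidl => x /=; rewrite !in_itv/= => /andP[-> /le_trans->].
  rewrite -[X in X = _]/(nuP _) nuPE// => E.
  by rewrite /Rintegral -[X in fine X]/(\int[leb]_(x in `]a, t]) ((EFin \o g) x))%E
    gE -E /= addrC subrK.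
have Pg' t : a <= t <= b ->
    D t + C * t = D a + C * a + \int[leb]_(x in `]a, t]) g x.
  by move=> tab; have := Pg t tab; rewrite PE.
exists g; split => //.
have locg : locally_integrable setT g.
  by apply: open_integrable_locally => //; exact: openT.
have intgS y : leb.-integrable [set` Interval (BRight a) (BRight y)] (EFin \o g).
  exact: integrableS intg.
have := FTC1 intgS locg.
apply: filterS; first exact: (ae_filter_ringOfSetsType leb).
move=> t /= tF /andP[at_ tb].
have [dF F'] := tF at_.
set F := fun x : R => _ in dF F'.
(* The integral formula is known on [[a, b]] only; [t] is interior, so it holds near [t], which
   suffices for the derivative. *)
apply: (@near_eq_is_derive _ _ _ (fun s => F s + (D a + C * a) - C * s)).
  have tab : t \in `]a, b[ by rewrite in_itv/= at_.
  have := near_in_itvoo tab; apply: filterS => s; rewrite in_itv/= => /andP[as_ sb].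
  have sab : a <= s <= b by rewrite !ltW.
  by have E := Pg' s sab; rewrite -/(F s) in E; rewrite /= (addrC (F s)) -E addrK.
have dF' : is_derive t (1 : R) F (g t) by split => //; rewrite -derive1E.
have dC : is_derive t (1 : R) (fun s : R => C * s) C.
  by apply: is_derive_eq; rewrite [C *: 1]mulr1.
by apply: is_derive_eq; rewrite addr0.
Qed.

Lemma lipschitz_ae_derivable (D : R -> R) (C a b : R) : 0 <= C ->
  (forall s t, `|D s - D t| <= C * `|s - t|) -> a < b ->
  {ae leb, forall t, a < t < b -> derivable D t (1 : R)}.
Proof.
move=> C0 lD ab; have [g [_ _]] := lipschitz_FTC C0 lD ab.
apply: filterS; first exact: (ae_filter_ringOfSetsType leb).
by move=> t h /h[].
Qed.

(** The density [g] of [D t + C * t] equals [C] almost everywhere, so its integral [C * (b - a)]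
    accounts for the whole increment of [C * t]. *)
Lemma lipschitz_ae_derive0 (D : R -> R) (C a b : R) : 0 <= C ->
  (forall s t, `|D s - D t| <= C * `|s - t|) -> a < b ->
  {ae leb, forall t, a < t < b -> is_derive t (1 : R) D 0} ->
  D b = D a.
Proof.
move=> C0 lD ab D'0.
have [g [intg gE D'g]] := lipschitz_FTC C0 lD ab.
have /gE : a <= b <= b by rewrite lexx ltW.
suff -> : \int[leb]_(x in `]a, b]) g x = C * (b - a).
  by rewrite mulrBr => E; lra.
rewrite -Rintegral_itv_bndo_bndc; last first.
  by apply: integrableS intg.
have aeC : {ae leb, forall t, a < t < b -> g t = C}.
  apply: (@filterS2 _ _ (ae_filter_ringOfSetsType leb) _ _ _ _ D'0 D'g).
  move=> t D't0 D'tg tab; have [_ d0] := D't0 tab; have [_ dg] := D'tg tab.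
  by move: dg; rewrite d0 => /eqP; rewrite eq_sym subr_eq0 => /eqP.
transitivity (fine (\int[leb]_(x in `]a, b[%classic) (cst C%:E) x)%E).
  rewrite /Rintegral; congr fine; apply: ae_eq_integral => //.
  - by apply: measurable_funTS; exact: measurable_int intg.
  - move: aeC; apply: filterS; first exact: (ae_filter_ringOfSetsType leb).
    by move=> t gC; rewrite /= in_itv/= => /gC ->.
have lebE : leb `]a, b[%classic = (b - a)%:E.
  by rewrite lebesgue_measure_itv/= lte_fin ab.
by rewrite integral_cst// -[X in fine X]/(C%:E * leb `]a, b[%classic)%E lebE.
Qed.
End lipschitz_FTC.

(** * Lipschitz reparametrisation of curves *)

Section reparametrization.
Context (R : realType).

(** The cells of a partition of [[u, v]] are disjoint intervals whose lengths telescope to [v - u],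
    so absolute continuity bounds the variation along each partition, and the supremum inherits the
    bound. *)
Lemma abs_continuous_total_variation (f : R -> R) (a b e : R) : 0 < e ->
  abs_continuous a b f ->
  exists2 delta, 0 < delta & forall u v, a <= u -> u <= v -> v <= b ->
    v - u < delta -> (total_variation u v f <= e%:E)%E.
Proof.
move=> e0 /(_ _ e0)[delta delta0 AC]; exists delta => // u v au uv vb uvd.
apply: ub_ereal_sup => _ /= [_ [s us <-] <-]; rewrite lee_fin.
have [us_path us_last] := us.
pose F := nth v (u :: s).
have Fmono i j : (i <= j)%N -> (j <= size s)%N -> F i <= F j.
  move=> ij js; rewrite /F lt_sorted_leq_nth ?inE ?ltnS//.
  exact: leq_trans js.
have F0 : F 0%N = u by [].
have Fs : F (size s) = v by exact: itv_partition_nth_size us.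
have /ltW : \sum_(i < size s) `|f (F i.+1) - f (F i)| < e.
  apply: (AC _ (fun i : 'I_(size s) => F i) (fun i => F i.+1)).
  - move=> i; split.
    + by rewrite (le_trans au)// -F0; exact: Fmono (leq0n _) (ltnW _).
    + exact: Fmono (leqnSn _) _.
    + by rewrite (le_trans _ vb)// -Fs; exact: Fmono (ltn_ord _) (leqnn _).
  - suff H (i j : 'I_(size s)) : (i < j)%N ->
        `]F i, F i.+1[%classic `&` `]F j, F j.+1[%classic = set0.
      apply/trivIsetP => i j _ _; rewrite neq_lt => /orP[|] ij; first exact: H.
      by rewrite setIC; exact: H.
    move=> ij; rewrite -subset0 => x [] /=; rewrite !in_itv/= => /andP[_ xi] /andP[jx _].
    have := lt_trans jx xi; rewrite ltNge; apply/negP/negPn.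
    exact: Fmono ij (ltnW _).
  - rewrite -(big_mkord xpredT (fun i => F i.+1 - F i)) telescope_sumr//.
    by rewrite Fs F0.
by rewrite /variation big_mkord.
Qed.

(** [[a, b]] is cut into [N.+1] pieces shorter than the [delta] belonging to 1; each piece
    contributes variation at most 1. *)
Lemma abs_continuous_bounded_variation (f : R -> R) (a b : R) : a <= b ->
  abs_continuous a b f -> total_variation a b f \is a fin_num.
Proof.
move=> ab /(abs_continuous_total_variation ltr01)[delta delta0 TV1].
have [N _ /(_ N (leqnn N))] : \forall N \near \oo, (b - a) / delta < N%:R.
  exact: nbhs_infty_gtr.
rewrite ltr_pdivrMr// => Nd.
have N0 : 0 < N.+1%:R :> R by [].
pose h := (b - a) / N.+1%:R.
have h0 : 0 <= h by rewrite divr_ge0// subr_ge0.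
have hd : h < delta.
  rewrite ltr_pdivrMr// (lt_le_trans Nd)// mulrC ler_wpM2l ?(ltW delta0)//.
  by rewrite ler_nat.
suff H k : (k <= N.+1)%N -> (total_variation a (a + k%:R * h) f <= k%:R%:E)%E.
  have := H _ (leqnn _); rewrite /h mulrC divfK ?gt_eqF// addrC subrK => TVN.
  by rewrite ge0_fin_numE ?total_variation_ge0// (le_lt_trans TVN)// ltry.
elim: k => [_|k IH kN]; first by rewrite mul0r addr0 total_variationxx.
have kh : a + k%:R * h <= a + k.+1%:R * h by rewrite lerD2l ler_wpM2r// ler_nat.
rewrite (@total_variationD _ _ _ (a + k%:R * h))//; last first.
  by rewrite lerDl mulr_ge0.
rewrite -natr1 EFinD leeD//; first by apply: IH; exact: ltnW.
apply: TV1 => //.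
- by rewrite lerDl mulr_ge0.
- by rewrite lerD2l ler_wpM2r// lerDl.
- rewrite -[leRHS](_ : a + (b - a) = _); last by ring.
  rewrite lerD2l /h mulrCA -[leRHS]mulr1 ler_wpM2l ?subr_ge0//.
  by rewrite ler_pdivrMr// mul1r natr1 ler_nat.
- have -> : a + (k%:R + 1) * h - (a + k%:R * h) = h by ring.
  exact: hd.
Qed.

Lemma abs_continuous_coord d (w : R -> 'rV[R]_d) (a b : R) j :
  abs_continuous a b w -> abs_continuous a b (fun t => w t 0 j).
Proof.
move=> AC e e0; have [delta delta0 H] := AC e e0.
exists delta => // n s t st triv std; apply: le_lt_trans (H n s t st triv std).
apply: ler_sum => i _.
by have /rV_norm_le - /(_ (normr_ge0 _) j) := lexx `|w (t i) - w (s i)|; rewrite !mxE.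
Qed.

Lemma abs_continuous_length d (w : R -> 'rV[R]_d) (a b : R) : a <= b ->
  abs_continuous a b w ->
  exists V : R -> R,
    (forall s t, a <= s -> s <= t -> t <= b -> `|w t - w s| <= V t - V s) /\
    (forall e, 0 < e -> exists2 delta, 0 < delta & forall s t,
       a <= s -> s <= t -> t <= b -> t - s < delta -> V t - V s <= e).
Proof.
move=> ab AC.
pose T j s t := total_variation s t (fun t => w t 0 j).
have Tfin j s t : a <= s -> s <= t -> t <= b -> T j s t \is a fin_num.
  move=> as_ st tb; have := abs_continuous_bounded_variation ab (abs_continuous_coord j AC).
  rewrite (@total_variationD _ _ _ s)//; last exact: le_trans tb.
  rewrite fin_numD => /andP[_]; rewrite (@total_variationD _ _ _ t)//.
  by rewrite fin_numD => /andP[].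
have TB j s t : a <= s -> s <= t -> t <= b ->
    fine (T j a t) - fine (T j a s) = fine (T j s t).
  move=> as_ st tb; rewrite /T (@total_variationD _ a t s)// fineD ?Tfin//.
    by rewrite addrC addKr.
  exact: le_trans tb.
(* The sum of the coordinate variations replaces arc length: it dominates the increments of [w] in
   the sup norm and is additive over intervals. *)
exists (fun t => \sum_j fine (T j a t)); split.
  move=> s t as_ st tb; rewrite -sumrB.
  under eq_bigr do rewrite TB//.
  have T0 j : 0 <= fine (T j s t) by rewrite fine_ge0// total_variation_ge0.
  apply/rV_norm_le; first by rewrite sumr_ge0.
  move=> j; rewrite (bigD1 j)//= ler_wpDr ?sumr_ge0// !mxE.
  rewrite -lee_fin fineK ?Tfin//.
  exact: (total_variation_ge (fun t => w t 0 j)).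
(* [d.+1] keeps the quotient meaningful for [d = 0]; for the same reason the minimum of the
   [delta j] below starts from 1. *)
move=> e e0; pose e' := e / d.+1%:R.
have e'0 : 0 < e' by rewrite divr_gt0.
have /choice[delta deltaP] : forall j : 'I_d, exists delta, 0 < delta /\
    forall u v, a <= u -> u <= v -> v <= b -> v - u < delta -> (T j u v <= e'%:E)%E.
  move=> j.
  have [dl] := abs_continuous_total_variation e'0 (abs_continuous_coord j AC).
  by exists dl.
exists (\big[Num.min/1]_j delta j).
  by apply/bigmin_gtP; split => // j _; have [] := deltaP j.
move=> s t as_ st tb /bigmin_gtP[_ std]; rewrite -sumrB.
under eq_bigr do rewrite TB//.
apply: (@le_trans _ _ (\sum_(j < d) e')).
  apply: ler_sum => j _; rewrite -lee_fin fineK ?Tfin//.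
  by have [_] := deltaP j; apply => //; exact: std.
rewrite sumr_const card_ord -mulr_natr /e' mulrAC ler_pdivrMr//.
by rewrite ler_wpM2l ?(ltW e0)// ler_nat.
Qed.

(** The curve is parametrised by [V]. Increments of [w] are at most those of [V], so in this
    parameter the curve is 1-Lipschitz. *)
Lemma rectifiable_reparametrization d (w : R -> 'rV[R]_d) : abs_continuous 0 1 w ->
  exists (l : R) (h : R -> 'rV[R]_d), [/\ 0 <= l,
    (forall u v, `|h u - h v| <= `|u - v|),
    (forall u, exists2 t, 0 <= t <= 1 & h u = w t), h 0 = w 0 & h l = w 1].
Proof.
move=> /(abs_continuous_length ler01)[V [wV Vcont]].
pose cl (x y t : R) := Num.max x (Num.min t y).
(* [V] is controlled on [[0, 1]] only; clamping its argument makes [W] continuous on the whole line,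
   ready for the intermediate value theorem. *)
pose W t := V (cl 0 1 t) - V 0.
have cl01 x y t : x <= y -> x <= cl x y t <= y.
  by move=> xy; rewrite /cl le_max lexx/= ge_max ge_min lexx orbT xy.
have cl_lip x y s t : `|cl x y s - cl x y t| <= `|s - t|.
  exact: maxmin_lipschitz.
have cl_id x y t : x <= t <= y -> cl x y t = t.
  by move=> /andP[xt ty]; rewrite /cl min_l// max_r.
have Vle s t : 0 <= s -> s <= t -> t <= 1 -> V s <= V t.
  by move=> s0 st t1; rewrite -subr_ge0 (le_trans _ (wV _ _ s0 st t1)).
have cW : continuous W.
  move=> t; apply/(@cvgrPdist_le _ R^o) => e e0.
  have [delta delta0 Vd] := Vcont _ e0.
  near=> s; rewrite /W opprB addrA subrK.
  have : `|cl 0 1 t - cl 0 1 s| < delta.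
    apply: le_lt_trans (cl_lip _ _ _ _) _.
    by near: s; apply: cvgr_dist_lt.
  have /andP[s0 s1] := cl01 0 1 s ler01.
  have /andP[t0 t1] := cl01 0 1 t ler01.
  have [st|/ltW ts] := leP (cl 0 1 s) (cl 0 1 t) => ltd.
    rewrite ger0_norm ?subr_ge0 ?Vle//; apply: Vd => //.
    by rewrite -[ltLHS]ger0_norm// subr_ge0.
  rewrite distrC ger0_norm ?subr_ge0 ?Vle//; apply: Vd => //.
  by rewrite -[ltLHS]ger0_norm ?subr_ge0// distrC.
pose l := V 1 - V 0.
have l0 : 0 <= l by rewrite subr_ge0 Vle.
(* [tau u] is any time at which [V] has grown by the clamped [u]. Where [V] is constant so is [w],
   hence the choice does not affect [w (tau u)]; this also settles the endpoints, although [tau 0]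
   may differ from 0. *)
have /choice[tau tauP] : forall u, exists t, 0 <= t <= 1 /\ V t - V 0 = cl 0 l u.
  move=> u.
  have [||t] := @IVT R W 0 1 (cl 0 l u) ler01.
  - exact: continuous_subspaceT.
  - have -> : W 0 = 0 by rewrite /W cl_id ?lexx ?ler01// subrr.
    have -> : W 1 = l by rewrite /W cl_id ?lexx ?ler01.
    by rewrite min_l// max_r// cl01.
  rewrite in_itv/= => t01 Wt; exists t; split => //.
  by rewrite -Wt /W cl_id.
have wVabs s t : 0 <= s <= 1 -> 0 <= t <= 1 -> `|w s - w t| <= `|V s - V t|.
  move=> /andP[s0 s1] /andP[t0 t1]; have [st|/ltW ts] := leP s t.
    rewrite distrC [leRHS]distrC ger0_norm ?subr_ge0 ?Vle//; exact: wV.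
  by rewrite [leRHS]ger0_norm ?subr_ge0 ?Vle//; exact: wV.
exists l, (fun u => w (tau u)); split => //.
- move=> u v; have [u01 Vu] := tauP u; have [v01 Vv] := tauP v.
  apply: le_trans (wVabs _ _ u01 v01) _.
  have -> : V (tau u) - V (tau v) = cl 0 l u - cl 0 l v by rewrite -Vu -Vv; ring.
  exact: cl_lip.
- by move=> u; have [u01 _] := tauP u; exists (tau u).
- have [t01 Vt] := tauP 0; apply/eqP; rewrite -subr_eq0 -normr_le0.
  apply: le_trans (wVabs _ _ t01 _) _; rewrite ?lexx ?ler01//.
  by rewrite Vt cl_id ?lexx// normr0.
- have [t01 Vt] := tauP l; apply/eqP; rewrite -subr_eq0 -normr_le0.
  apply: le_trans (wVabs _ _ t01 _) _; rewrite ?lexx ?ler01//.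
  have -> : V (tau l) - V 1 = (V (tau l) - V 0) - l by rewrite /l; ring.
  by rewrite Vt cl_id ?lexx ?l0// subrr normr0.
Unshelve. all: by end_near. Qed.
End reparametrization.

(** * Differences of potentials along a curve *)

Lemma derive_at_minimum (R : realType) (f : R -> R) (t : R) :
  derivable f t 1 -> (forall s, f t <= f s) -> 'D_1 f t = 0.
Proof.
move=> df fmin; set D := 'D_1 f t.
pose q (h : R) : R := h^-1 * (f (h * 1 + t) - f t).
have qD : q @ 0^' --> D := df.
have near_q e : 0 < e -> exists2 r, 0 < r & forall h, `|h| < r -> h != 0 -> `|D - q h| < e.
  move=> e0; have [r /= r0 H] := (@cvgrPdist_lt _ R^o _ _ _ _ _).1 qD e e0.
  by exists r => // h hr; apply: H; rewrite /= sub0r normrN.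
have fge0 h : 0 <= f (h * 1 + t) - f t by rewrite subr_ge0.
apply/eqP; rewrite eq_le; apply/andP; split; rewrite leNgt; apply/negP => D0.
- have [r r0 H] := near_q _ D0.
  have r20 : 0 < r / 2 by rewrite divr_gt0.
  have := H (- (r / 2)); rewrite normrN gtr0_norm// => /(_ _ _).
  rewrite oppr_eq0 gt_eqF// ltr_pdivrMr// ltr_pMr// ltr1n => /(_ erefl erefl).
  have : q (- (r / 2)) <= 0.
    by rewrite /q invrN mulNr oppr_le0 mulr_ge0// invr_ge0 ltW.
  by rewrite ltr_norml => ? /andP[_ ?]; lra.
- have D0' : 0 < - D by rewrite oppr_gt0.
  have [r r0 H] := near_q _ D0'.
  have r20 : 0 < r / 2 by rewrite divr_gt0.
  have := H (r / 2); rewrite gtr0_norm// => /(_ _ _).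
  rewrite gt_eqF// ltr_pdivrMr// ltr_pMr// ltr1n => /(_ erefl erefl).
  have : 0 <= q (r / 2) by rewrite /q mulr_ge0// invr_ge0 ltW.
  by rewrite ltr_norml => ? /andP[? _]; lra.
Qed.

Section curve.
Context (R : realType) (d : nat).
Local Notation X := 'rV[R]_d.
Local Notation leb := (@lebesgue_measure R).

(** For almost every [t], the functions [h], [f0 \o h] and [f1 \o h] are differentiable at [t]. One
    and the same [y] makes [c (h s) y - f (h s)] minimal at [s = t] for both potentials, so both
    have the derivative of [c (h s) y] there and their difference has derivative 0. *)
Lemma curve_difference_constant (c : X -> X -> R) (f0 f1 : X -> R) (A : set X)
    (C l : R) (h : R -> X) :
  (forall x y, differentiable (c^~ y) x) -> 0 <= C ->
  (forall x x', `|f0 x - f0 x'| <= C * `|x - x'|) ->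
  (forall x x', `|f1 x - f1 x'| <= C * `|x - x'|) ->
  (forall x, A x -> exists y, forall x', A x' ->
     c x y - f0 x <= c x' y - f0 x' /\
     c x y - f1 x <= c x' y - f1 x') ->
  0 <= l -> (forall u v, `|h u - h v| <= `|u - v|) -> (forall u, A (h u)) ->
  f0 (h l) - f1 (h l) = f0 (h 0) - f1 (h 0).
Proof.
move=> dc C0 lf0 lf1 Amin; rewrite le_eqVlt => /predU1P[<- //|l0] lh Ah.
have lD (f : X -> R) : (forall x x', `|f x - f x'| <= C * `|x - x'|) ->
    forall s t, `|f (h s) - f (h t)| <= C * `|s - t|.
  by move=> lf s t; apply: le_trans (lf _ _) _; rewrite ler_wpM2l.
have lhj (j : 'I_d) s t : `|h s 0 j - h t 0 j| <= 1 * `|s - t|.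
  rewrite mul1r; apply: le_trans (lh s t).
  by have /rV_norm_le - /(_ (normr_ge0 _) j) := lexx `|h s - h t|; rewrite !mxE.
have C20 : 0 <= 2 * C by rewrite mulr_ge0.
apply: (@lipschitz_ae_derive0 _ (fun t => f0 (h t) - f1 (h t)) (2 * C)) => //.
  move=> s t; have l0' := lD _ lf0 s t; have l1' := lD _ lf1 s t.
  have -> : f0 (h s) - f1 (h s) - (f0 (h t) - f1 (h t)) =
    (f0 (h s) - f0 (h t)) - (f1 (h s) - f1 (h t)) by ring.
  apply: le_trans (ler_normB _ _) _.
  have -> : 2 * C * `|s - t| = C * `|s - t| + C * `|s - t| by ring.
  exact: lerD.
have aeF : Filter (almost_everywhere leb) by exact: ae_filter_ringOfSetsType.
(* A vector-valued curve is differentiable once its finitely many coordinates are, and each of these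
   is 1-Lipschitz. *)
have ae_h : {ae leb, forall t, forall j : 'I_d, 0 < t < l ->
    derivable (fun s => h s 0 j) t (1 : R)}.
  apply: filter_forall => j.
  exact: (lipschitz_ae_derivable ler01 (lhj j) l0).
have ae0 := lipschitz_ae_derivable C0 (lD _ lf0) l0.
have ae1 := lipschitz_ae_derivable C0 (lD _ lf1) l0.
apply: (@filterS3 _ _ aeF _ _ _ _ _ ae_h ae0 ae1).
move=> t dh d0 d1 tl.
have {d0} d0 := d0 tl; have {d1} d1 := d1 tl.
have {dh} dh : derivable h t (1 : R).
  by apply/derivable_mxP => i j; rewrite ord1; exact: dh.
have [y yP] := Amin _ (Ah t).
pose g s := c (h s) y.
have dg : derivable g t (1 : R).
  apply/derivable1_diffP.
  by apply: (@differentiable_comp _ _ _ _ h (c^~ y)) => //; exact/derivable1_diffP.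
have min0 (f : X -> R) : derivable (fun s => f (h s)) t (1 : R) ->
    (forall s, c (h t) y - f (h t) <= c (h s) y - f (h s)) ->
    'D_1 (fun s => f (h s)) t = 'D_1 g t.
  move=> df fmin; apply/eqP; rewrite eq_sym -subr_eq0 -deriveB//; apply/eqP.
  by apply: derive_at_minimum; [exact: derivableB|exact: fmin].
split; first exact: derivableB.
rewrite deriveB// (min0 f0)// ?(min0 f1)// ?subrr// => s.
  by have [] := yP _ (Ah s).
by have [] := yP _ (Ah s).
Qed.
End curve.

(** * Cyclic exchange of mass *)

Section probability_constructions.
Local Open Scope ereal_scope.
Context (R : realType).

Lemma conditional_probability d (T : measurableType d) (P : probability T R)
    (U : set T) : measurable U -> 0 < P U ->
  exists Q : probability T R,
    forall E, Q E = P (E `&` U) * ((fine (P U))^-1)%:E.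
Proof.
move=> mU PU; pose m : {measure set T -> \bar R} := mrestr P mU.
have mT : m setT = P U by rewrite /m /= /mrestr setTI.
have PUf : (P U == 0) || (P U == +oo) = false.
  by rewrite gt_eqF//= lt_eqF// (le_lt_trans (probability_le1 P mU))// ltry.
have mE E : mnormalize m P E = m E * ((fine (P U))^-1)%:E.
  by rewrite /mnormalize mT PUf.
by exists (mnormalize m P) => E; exact: mE.
Qed.

Lemma image_probability d d' (T : measurableType d) (T' : measurableType d')
    (P : probability T R) (f : T -> T') : measurable_fun setT f ->
  exists Q : probability T' R, forall E, Q E = P (f @^-1` E).
Proof.
move=> mf.
pose F : {mfun T >-> T'} := HB.pack f (isMeasurableFun.Build _ _ _ _ f mf).
by exists (distribution P F).
Qed.

Lemma product_probability d d' (T : measurableType d) (T' : measurableType d')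
    (P : probability T R) (Q : probability T' R) :
  exists S : probability (T * T')%type R, forall A B,
    measurable A -> measurable B -> S (A `*` B) = P A * Q B.
Proof.
have S1 : (P \x Q) setT = 1.
  rewrite -setXTT; transitivity (P setT * Q setT).
    exact: product_measure1E.
  by rewrite !probability_setT mul1e.
pose S : probability (T * T')%type R :=
  HB.pack (P \x Q)%E (Measure_isProbability.Build _ _ _ (P \x Q)%E S1).
by exists S => A B mA mB; exact: product_measure1E.
Qed.

(** Normalising a measure of mass 1 leaves it unchanged but equips it with the structure of a
    probability. [P0] is only the fallback value of [mnormalize] for mass 0 or infinity. *)
Lemma unit_measure_probability d (T : measurableType d) (P0 : probability T R)
    (m : {measure set T -> \bar R}) : m setT = 1 ->
  exists P : probability T R, P = m :> (set T -> \bar R).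
Proof.
move=> m1; have mE : mnormalize m P0 = m :> (set T -> \bar R).
  apply/funext => E; rewrite /mnormalize m1 ifF.
    by rewrite /= invr1 mule1.
  by rewrite onee_eq0.
by exists (mnormalize m P0); exact: mE.
Qed.

Lemma measure_difference d (T : measurableType d)
    (m1 m2 : {measure set T -> \bar R}) : m1 setT < +oo ->
  (forall E, measurable E -> m2 E <= m1 E) ->
  exists m : {measure set T -> \bar R},
    forall E, measurable E -> m1 E = m E + m2 E.
Proof.
move=> m1oo m21.
have fin1 E : measurable E -> m1 E \is a fin_num.
  move=> mE; rewrite ge0_fin_numE// (le_lt_trans _ m1oo)//.
  by rewrite le_measure ?inE.
have fin2 E : measurable E -> m2 E \is a fin_num.
  move=> mE; rewrite ge0_fin_numE// (le_lt_trans (m21 _ mE))//.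
  by rewrite -ge0_fin_numE// fin1.
(* A measure must be nonnegative on every set, so m0 is cut off outside the
   sigma-algebra. *)
pose m0 E := if E \in @measurable _ T then m1 E - m2 E else 0.
have m0E E : measurable E -> m0 E = m1 E - m2 E by move=> mE; rewrite /m0 mem_set.
have m00 : m0 set0 = 0 by rewrite m0E// !measure0 sube0.
have m0_ge0 E : 0 <= m0 E.
  by rewrite /m0; case: ifPn => // /set_mem mE; rewrite sube_ge0 ?m21// fin2.
have m0_additive : semi_sigma_additive m0.
  move=> F mF tF mUF; rewrite m0E//.
  rewrite [X in X @ _ --> _](_ : _ = (fun n => \sum_(0 <= i < n) m1 (F i) -
      \sum_(0 <= i < n) m2 (F i))); last first.
    apply/funext => n; under eq_bigr do rewrite m0E//.
    by rewrite big_split/= fin_num_sumeN// => i _; rewrite fin2.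
  apply: cvgeB; first by rewrite fin_num_adde_defr// fin1.
    exact: measure_semi_sigma_additive.
  exact: measure_semi_sigma_additive.
pose m : {measure set T -> \bar R} :=
  HB.pack m0 (isMeasure.Build _ _ _ m0 m00 m0_ge0 m0_additive).
by exists m => E mE; rewrite /m /= m0E// subeK ?fin2.
Qed.

Lemma ge0_integral_le_cst d (T : measurableType d) (P : probability T R)
    (h : T -> R) (D : set T) (b : R) : measurable_fun setT h ->
  (forall x, 0 <= h x)%R -> measurable D -> P D = 1 ->
  (forall x, D x -> h x <= b)%R -> \int[P]_x (h x)%:E <= b%:E.
Proof.
move=> mh h0 mD PD hb.
have PDc : P (~` D) = 0 by rewrite probability_setC// PD subee.
have D0 : D !=set0.
  by apply/set0P/eqP => D0; move: PD; rewrite D0 measure0 => /esym/eqP; rewrite onee_eq0.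
have b0 : (0 <= b)%R by have [x Dx] := D0; rewrite (le_trans (h0 x))// hb.
apply: (@le_trans _ _ (\int[P]_x (cst b%:E) x)).
  apply: ae_ge0_le_integral => //.
  - by move=> x _; rewrite lee_fin.
  - exact/measurable_EFinP.
  - exists (~` D); split; first exact: measurableC.
      exact: PDc.
    by move=> x /=; apply: contra_not => Dx _; rewrite lee_fin hb.
by rewrite integral_cst//= probability_setT mule1.
Qed.

Lemma ge0_integral_ge_cst d (T : measurableType d) (P : probability T R)
    (h : T -> R) (D : set T) (a : R) : measurable_fun setT h ->
  (forall x, 0 <= h x)%R -> measurable D -> P D = 1 -> (0 <= a)%R ->
  (forall x, D x -> a <= h x)%R -> a%:E <= \int[P]_x (h x)%:E.
Proof.
move=> mh h0 mD PD a0 ha.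
have PDc : P (~` D) = 0 by rewrite probability_setC// PD subee.
have <- : \int[P]_x (cst a%:E) x = a%:E.
  by rewrite integral_cst//= probability_setT mule1.
apply: ae_ge0_le_integral => //.
- by move=> x _; rewrite lee_fin.
- exact/measurable_EFinP.
- exists (~` D); split; first exact: measurableC.
    exact: PDc.
  by move=> x /=; apply: contra_not => Dx _; rewrite lee_fin ha.
Qed.

(* gamma' removes from gamma a multiple of its normalised restrictions G i to
   S i x U i and adds the same multiple of the products of the first marginal of
   G (p i) with the second marginal of G i. *)
Lemma cyclic_competitor d1 d2 (T1 : measurableType d1) (T2 : measurableType d2)
    (gamma : probability (T1 * T2)%type R) (k : T1 * T2 -> R) (M : R)
    (n : nat) (p : nat -> nat) (S : nat -> set T1) (U : nat -> set T2)
    (a b : nat -> R) :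
  measurable_fun setT k -> (forall z, 0 <= k z <= M)%R -> (0 < n)%N ->
  (forall i, measurable (S i)) -> (forall i, measurable (U i)) ->
  (forall i, 0 < gamma (S i `*` U i)) -> (forall i, 0 <= a i)%R ->
  (forall i z, (S i `*` U i) z -> a i <= k z)%R ->
  (forall i z, (S (p i) `*` U i) z -> k z <= b i)%R ->
  (forall F : nat -> \bar R, \sum_(i < n) F (p i) = \sum_(i < n) F i) ->
  (\sum_(i < n) b i < \sum_(i < n) a i)%R ->
  exists gamma' : probability (T1 * T2)%type R,
    [/\ forall A, measurable A -> gamma' (fst @^-1` A) = gamma (fst @^-1` A),
        forall B, measurable B -> gamma' (snd @^-1` B) = gamma (snd @^-1` B) &
        \int[gamma']_z (k z)%:E < \int[gamma]_z (k z)%:E].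
Proof.
move=> mk k0M n0 mS mU gamma0 a0 ak kb psum ba.
have k0 z : (0 <= k z)%R by have /andP[] := k0M z.
have mSU i : measurable (S i `*` U i) by exact: measurableX.
pose m i := fine (gamma (S i `*` U i)).
have mE i : (m i)%:E = gamma (S i `*` U i).
  by rewrite /m fineK// fin_num_measure.
have m0 i : (0 < m i)%R by rewrite -lte_fin mE.
have /choice[G GE] : forall i, exists Q : probability (T1 * T2)%type R,
    forall E, Q E = gamma (E `&` (S i `*` U i)) * ((m i)^-1)%:E.
  by move=> i; exact: conditional_probability.
have GSU i : G i (S i `*` U i) = 1.
  by rewrite GE setIid -mE -EFinM divff// gt_eqF.
have /choice[X XE] : forall i, exists Q : probability T1 R,
    forall A, Q A = G i (fst @^-1` A).
  by move=> i; exact: image_probability.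
have /choice[Y YE] : forall i, exists Q : probability T2 R,
    forall B, Q B = G i (snd @^-1` B).
  by move=> i; exact: image_probability.
have /choice[Pi PiE] : forall i, exists Q : probability (T1 * T2)%type R,
    forall A B, measurable A -> measurable B -> Q (A `*` B) = X (p i) A * Y i B.
  by move=> i; exact: product_probability.
have prob1 (Q : probability (T1 * T2)%type R) (A B : set (T1 * T2)) :
    measurable A -> measurable B -> A `<=` B -> Q A = 1 -> Q B = 1.
  move=> mA mB AB QA; apply/eqP; rewrite eq_le probability_le1//= -QA.
  by rewrite le_measure ?inE.
have mfst A : measurable A -> measurable (fst @^-1` A : set (T1 * T2)).
  by move=> mA; rewrite -[X in measurable X]setTI; exact: measurable_fst.
have msnd A : measurable A -> measurable (snd @^-1` A : set (T1 * T2)).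
  by move=> mA; rewrite -[X in measurable X]setTI; exact: measurable_snd.
have PiSU i : Pi i (S (p i) `*` U i) = 1.
  rewrite PiE// XE YE (prob1 _ (S (p i) `*` U (p i)))//; last 2 first.
  - exact: mfst.
  - by move=> z [].
  rewrite (prob1 _ (S i `*` U i))// ?mule1//; first exact: msnd.
  by move=> z [].
have Pifst i A : measurable A -> Pi i (fst @^-1` A) = G (p i) (fst @^-1` A).
  move=> mA; have -> : fst @^-1` A = A `*` setT :> set (T1 * T2).
    by apply/seteqP; split => z //= [].
  rewrite PiE// XE YE preimage_setT probability_setT mule1.
  by congr (G _ _); apply/seteqP; split => z //= [].
have Pisnd i B : measurable B -> Pi i (snd @^-1` B) = G i (snd @^-1` B).
  move=> mB; have -> : snd @^-1` B = setT `*` B :> set (T1 * T2).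
    by apply/seteqP; split => z //= [].
  rewrite PiE// XE YE preimage_setT probability_setT mul1e.
  by congr (G _ _); apply/seteqP; split => z //= [].
(* Since [G i <= gamma / m i], the sum of the [G i] is at most [w * gamma]; the factor [w^-1]
   therefore removes no more mass than [gamma] has. *)
pose w := (\sum_(i < n) (m i)^-1)%R.
have w0 : (0 < w)%R.
  rewrite /w (bigD1 (Ordinal n0))//= ltr_wpDr ?invr_gt0//.
  by apply: sumr_ge0 => i _; rewrite invr_ge0 ltW.
have e0 : (0 <= w^-1)%R by rewrite invr_ge0 ltW.
pose e := NngNum e0.
pose N1 : {measure set (T1 * T2)%type -> \bar R} :=
  measure_add gamma (mscale e (msum (fun i => Pi i : {measure set _ -> \bar R}) n)).
pose N2 : {measure set (T1 * T2)%type -> \bar R} :=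
  mscale e (msum (fun i => G i : {measure set _ -> \bar R}) n).
have N1E E : N1 E = gamma E + (w^-1)%:E * \sum_(i < n) Pi i E.
  exact: measure_addE.
have N2E E : N2 E = (w^-1)%:E * \sum_(i < n) G i E by [].
have sumfin (Q : nat -> probability (T1 * T2)%type R) E : measurable E ->
    \sum_(i < n) Q i E \is a fin_num.
  by move=> mE'; apply/sum_fin_numP => i _ _; rewrite fin_num_measure.
have N21 E : measurable E -> N2 E <= N1 E.
  move=> mE'; apply: (@le_trans _ _ (gamma E)); last first.
    rewrite N1E leeDl// mule_ge0 ?lee_fin//.
    by apply: sume_ge0 => i _.
  rewrite N2E -[leRHS]mul1e -[1%:E in leRHS](_ : (w^-1)%:E * w%:E = 1).
    rewrite -muleA lee_pmul2l ?lte_fin ?invr_gt0// /w -sumEFin ge0_sume_distrl.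
      apply: lee_sum => i _; rewrite GE muleC lee_wpmul2l//.
        by rewrite lee_fin invr_ge0 ltW.
      by rewrite le_measure ?inE//; exact: measurableI.
    by move=> i _; rewrite lee_fin invr_ge0 ltW.
  by rewrite -EFinM mulVf// gt_eqF.
have N1oo : N1 setT < +oo.
  by rewrite -ge0_fin_numE// N1E fin_numD fin_num_measure//= fin_numM// sumfin.
have [g0 g0E] := measure_difference N1oo N21.
(* On a set to which the [Pi i] and the [G i] give the same total, the exchange has no effect. This
   yields the total mass and both marginals; for the first marginal the totals agree by [psum]. *)
have cancel E : measurable E -> \sum_(i < n) Pi i E = \sum_(i < n) G i E ->
    g0 E = gamma E.
  move=> mE' PG; have := g0E _ mE'; rewrite N1E N2E PG.
  move=> /(congr1 (fun x => x - (w^-1)%:E * \sum_(i < n) G i E)).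
  by rewrite !addeK ?fin_numM ?sumfin.
have g0T : g0 setT = 1.
  rewrite cancel// ?probability_setT//.
  by apply: eq_bigr => i _; rewrite !probability_setT.
have [g gE] := unit_measure_probability gamma g0T.
exists g; split.
- move=> A mA; rewrite gE cancel//; first exact: mfst.
  under eq_bigr do rewrite Pifst//.
  exact: (psum (fun i => G i (fst @^-1` A))).
- move=> A mA; rewrite gE cancel//; first exact: msnd.
  by apply: eq_bigr => i _; rewrite Pisnd.
(* The balance of costs is stated additively, so that no extended reals are subtracted before all
   integrals are known to be finite. *)
have intE : \int[gamma]_z (k z)%:E +
    (w^-1)%:E * \sum_(i < n) \int[Pi i]_z (k z)%:E =
    \int[g]_z (k z)%:E + (w^-1)%:E * \sum_(i < n) \int[G i]_z (k z)%:E.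
  have mk' : measurable_fun setT (EFin \o k) by exact/measurable_EFinP.
  have k0' z : setT z -> 0 <= (EFin \o k) z by rewrite lee_fin.
  transitivity (\int[N1]_z (k z)%:E).
    rewrite ge0_integral_measure_add//; congr (_ + _).
    rewrite ge0_integral_mscale//; congr (_ * _).
    by rewrite ge0_integral_measure_sum.
  rewrite gE; transitivity (\int[measure_add g0 N2]_z (k z)%:E).
    by apply: eq_measure_integral => E mE' _; rewrite (g0E _ mE'); exact/esym/measure_addE.
  rewrite ge0_integral_measure_add//; congr (_ + _).
  rewrite ge0_integral_mscale//; congr (_ * _).
  by rewrite ge0_integral_measure_sum.
have fin (Q : probability (T1 * T2)%type R) :
    \int[Q]_z (k z)%:E = (fine (\int[Q]_z (k z)%:E))%:E.
  rewrite fineK// ge0_fin_numE; last by apply: integral_ge0 => z _; rewrite lee_fin.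
  apply: (@le_lt_trans _ _ M%:E); last by rewrite ltry.
  apply: (ge0_integral_le_cst mk k0 measurableT); first exact: probability_setT.
  by move=> z _; have /andP[] := k0M z.
move: intE; rewrite (fin gamma) (fin g) lte_fin.
under eq_bigr do rewrite fin.
under [X in _ = _ + _ * X]eq_bigr do rewrite fin.
rewrite !sumEFin -!EFinM -!EFinD => -[] intE.
(* [G i] gives full mass to [S i x U i], where [k] is at least [a i], and [Pi i] to [S (p i) x U i],
   where [k] is at most [b i]. *)
have Gle : (\sum_(i < n) a i <= \sum_(i < n) fine (\int[G i]_z (k z)%:E))%R.
  apply: ler_sum => i _; rewrite -lee_fin -fin.
  exact: (ge0_integral_ge_cst mk k0 (mSU i) (GSU i) (a0 i) (ak i)).
have Pile : (\sum_(i < n) fine (\int[Pi i]_z (k z)%:E) <= \sum_(i < n) b i)%R.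
  apply: ler_sum => i _; rewrite -lee_fin -fin.
  apply: (ge0_integral_le_cst mk k0 _ (PiSU i)) => //; last exact: kb.
  exact: measurableX.
have : (w^-1 * \sum_(i < n) fine (\int[Pi i]_z (k z)%:E) <
        w^-1 * \sum_(i < n) fine (\int[G i]_z (k z)%:E))%R.
  rewrite ltr_pM2l ?invr_gt0//.
  exact: le_lt_trans Pile (lt_le_trans ba Gle).
lra.
Qed.
End probability_constructions.

(** * Dual potentials *)

(** This lower envelope yields every c-transform below and Rockafellar's potential. A lower bound at
    the single point [x0] reaches all points through the oscillation bound [N], so the infimum is
    finite everywhere. *)
Lemma inf_of_equilipschitz (R : realType) (V : normedModType R) (T : Type)
    (S : set T) (F : T -> V -> R) (C N : R) :
  S !=set0 ->
  (forall s x x', S s -> `|F s x - F s x'| <= C * `|x - x'|) ->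
  (forall s x x', S s -> `|F s x - F s x'| <= N) ->
  (exists x0 B, forall s, S s -> B <= F s x0) ->
  exists G : V -> R, [/\ forall s x, S s -> G x <= F s x,
    forall x m, (forall s, S s -> m <= F s x) -> m <= G x,
    forall x x', `|G x - G x'| <= C * `|x - x'| &
    forall x x', `|G x - G x'| <= N].
Proof.
move=> [s0 Ss0] FC FN [x0 [B FB]].
pose E x := [set F s x | s in S].
have E0 x : E x !=set0 by exists (F s0 x); exists s0.
have Elb x : has_lbound (E x).
  exists (B - N) => _ [s Ss <-].
  by have := FN s x x0 Ss; have := FB s Ss; rewrite ler_norml => ? /andP[? _]; lra.
have GF s x : S s -> inf (E x) <= F s x by move=> Ss; apply: ge_inf => //; exists s.
have Gm x m : (forall s, S s -> m <= F s x) -> m <= inf (E x).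
  by move=> H; apply: lb_le_inf => // _ [s Ss <-]; exact: H.
have GD D x x' : (forall s, S s -> `|F s x - F s x'| <= D) ->
    `|inf (E x) - inf (E x')| <= D.
  move=> FD; rewrite ler_norml; apply/andP; split.
    suff : inf (E x') - D <= inf (E x) by lra.
    apply: Gm => s Ss; have := GF s x' Ss; have := FD s Ss.
    by rewrite ler_norml => /andP[? ?] ?; lra.
  suff : inf (E x) - D <= inf (E x') by lra.
  apply: Gm => s Ss; have := GF s x Ss; have := FD s Ss.
  by rewrite ler_norml => /andP[? ?] ?; lra.
exists (fun x => inf (E x)); split => //.
- by move=> x x'; apply: GD => s; exact: FC.
- by move=> x x'; apply: GD => s; exact: FN.
Qed.

Section kantorovich.
Context (R : realType) (d : nat).
Local Notation X := 'rV[R]_d.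
Context (c : X * X -> R) (rho mu : probability X R).
Context (k : X -> X -> R) (C M : R).
Hypothesis lk : lipschitz_cost C M k.
Local Notation K := (spt rho).
Local Notation L := (spt mu).
Hypothesis kc : forall x y, K x -> L y -> k x y = c (x, y).

Lemma spt_measurable (nu : probability X R) : measurable (spt nu).
Proof. by apply: closed_rV_measurable; exact: closed_spt. Qed.

Lemma spt_probability (nu : probability X R) : nu (spt nu) = 1%E.
Proof.
rewrite -(setCK (spt nu)) probability_setC.
  by rewrite (rV_spt_setC_null nu) sube0.
apply: measurableC; exact: spt_measurable.
Qed.

Lemma spt_neq0 (nu : probability X R) : spt nu !=set0.
Proof.
apply/set0P/eqP => nu0; have := spt_probability nu.
by rewrite nu0 measure0 => /esym/eqP; rewrite onee_eq0.
Qed.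

Definition good_pair (N : R) (f g : X -> R) :=
  [/\ forall x x', `|f x - f x'| <= C * `|x - x'|,
      forall y y', `|g y - g y'| <= C * `|y - y'|,
      forall x, `|f x| <= N, forall y, `|g y| <= N &
      forall x y, K x -> L y -> f x + g y <= k x y].

(** [f] is the c-transform of [psi], shifted by [l] to vanish at a point [x0] of [K], and [g] is the
    c-transform of [f]. The shift turns the oscillation bound into [|f| <= 2 * M], and then
    [|g| <= 3 * M]. *)
Lemma c_transform_improvement (phi psi : X -> \bar R) :
  (forall x, phi x != +oo%E) -> (forall y, psi y != +oo%E) ->
  (forall x y, K x -> L y -> (phi x + psi y <= (k x y)%:E)%E) ->
  (exists2 x, K x & phi x \is a fin_num) ->
  (exists2 y, L y & psi y \is a fin_num) ->
  exists f g l, [/\ good_pair (3 * M) f g,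
    forall x, K x -> (phi x <= (f x + l)%:E)%E &
    forall y, L y -> (psi y <= (g y - l)%:E)%E].
Proof.
case: lk => C0 M0 kM klx kly phioo psioo phipsi [x1 Kx1 phi1] [y1 Ly1 psi1].
have finE (h : \bar R) : h != +oo%E -> h != -oo%E -> h = (fine h)%:E.
  by move=> h1 h2; rewrite fineK// fin_numE h1 h2.
have kMM x y x' y' : `|k x y - k x' y'| <= 2 * M.
  apply: le_trans (ler_normB _ _) _.
  by rewrite (_ : 2 * M = M + M) ?lerD//; ring.
(* Points with [psi y = -oo] impose no constraint and must be left out, because [fine] would send
   that value to 0. *)
pose S := [set y | L y /\ psi y != -oo%E].
have psiS x y : K x -> S y -> phi x != -oo%E -> fine (phi x) + fine (psi y) <= k x y.
  move=> Kx [Ly py] px; have := phipsi _ _ Kx Ly.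
  by rewrite (finE (phi x))// (finE (psi y))// -EFinD lee_fin.
have [||||f0 [f0F f0m f0C f0N]] :=
    @inf_of_equilipschitz _ X _ S (fun y x => k x y - fine (psi y)) C (2 * M).
- by exists y1; split => //; move: psi1; rewrite fin_numE => /andP[].
- move=> y x x' _ /=.
  by have -> : k x y - fine (psi y) - (k x' y - fine (psi y)) = k x y - k x' y by ring.
- move=> y x x' _ /=.
  by have -> : k x y - fine (psi y) - (k x' y - fine (psi y)) = k x y - k x' y by ring.
- exists x1, (fine (phi x1)) => y Sy; rewrite lerBrDr; apply: psiS => //.
  by move: phi1; rewrite fin_numE => /andP[].
have [x0 Kx0] := spt_neq0 rho.
pose f x := f0 x - f0 x0.
have fM x : `|f x| <= 2 * M by exact: f0N.
have [||||g [gF gm gC gN]] :=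
    @inf_of_equilipschitz _ X _ K (fun x y => k x y - f x) C (2 * M).
- by exists x0.
- move=> x y y' _ /=.
  by have -> : k x y - f x - (k x y' - f x) = k x y - k x y' by ring.
- move=> x y y' _ /=.
  by have -> : k x y - f x - (k x y' - f x) = k x y - k x y' by ring.
- exists y1, (- (3 * M)) => x _.
  by have := fM x; have := kM x y1; rewrite !ler_norml => /andP[? ?] /andP[? ?]; lra.
exists f, g, (f0 x0); split; first split => //.
- by move=> x x'; have -> : f x - f x' = f0 x - f0 x' by rewrite /f; ring.
- by move=> x; apply: le_trans (fM x) _; lra.
- move=> y; rewrite ler_norml; apply/andP; split.
    apply: gm => x _.
    by have := fM x; have := kM x y; rewrite !ler_norml => /andP[? ?] /andP[? ?]; lra.
  have := gF _ y Kx0; rewrite /f subrr subr0; have := kM x0 y.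
  by rewrite ler_norml => /andP[? ?]; lra.
- by move=> x y Kx Ly; have := gF _ y Kx; lra.
- move=> x Kx; rewrite /f subrK; have [->|px] := eqVneq (phi x) -oo%E.
    exact: leNye.
  rewrite (finE (phi x))// lee_fin; apply: f0m => y Sy.
  by have := psiS _ _ Kx Sy px; lra.
- move=> y Ly; have [->|py] := eqVneq (psi y) -oo%E; first exact: leNye.
  have Sy : S y by [].
  rewrite (finE (psi y))// lee_fin lerBrDr; apply: gm => x Kx.
  by have := f0F _ x Sy; rewrite /f; lra.
Qed.

Lemma bounded_lipschitz_integrable (nu : probability X R) (f : X -> R) (N : R) :
  (forall x x', `|f x - f x'| <= C * `|x - x'|) -> (forall x, `|f x| <= N) ->
  nu.-integrable setT (EFin \o f).
Proof.
move=> lf fN; apply: measurable_bounded_integrable => //.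
- by rewrite (le_lt_trans (probability_le1 nu measurableT))// ltry.
- apply: continuous_rV_measurable; exact: lipschitz_is_continuous lf.
- exists N; split; first exact: num_real.
  by move=> r Nr x _; rewrite /= (le_trans (fN x))// ltW.
Qed.

(** The value [-oo] off the support makes the constraint hold on the whole space for [c], which
    agrees with [k] on [K x L] only. Integrals do not change, as the complement of the support is
    null. *)
Definition cut (S : set X) (f : X -> R) : X -> \bar R :=
  fun x => if x \in S then (f x)%:E else -oo%E.

Lemma ae_spt (nu : probability X R) (P : X -> Prop) :
  (forall x, spt nu x -> P x) -> {ae nu, forall x, P x}.
Proof.
move=> H; exists (~` spt nu); split; first by apply: measurableC; exact: spt_measurable.
  exact: rV_spt_setC_null.
by move=> x /=; apply: contra_not; exact: H.
Qed.

Lemma cut_measurable (nu : probability X R) (f : X -> R) :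
  measurable_fun setT f -> measurable_fun setT (cut (spt nu) f).
Proof.
move=> mf; apply: measurable_fun_if => //.
- apply: (measurable_fun_bool true); rewrite setTI.
  rewrite (_ : _ @^-1` _ = spt nu); first exact: spt_measurable.
  by apply/seteqP; split => x /=; [exact: set_mem|exact: mem_set].
- by apply: measurable_funTS; exact/measurable_EFinP.
Qed.

Lemma cut_integral (nu : probability X R) (f : X -> R) : measurable_fun setT f ->
  (\int[nu]_x cut (spt nu) f x = \int[nu]_x (f x)%:E)%E.
Proof.
move=> mf; apply: ae_eq_integral => //.
- exact: cut_measurable.
- exact/measurable_EFinP.
- by apply: ae_spt => x Kx _; rewrite /cut mem_set.
Qed.

Lemma cut_potential (nu : probability X R) (f : X -> R) (N : R) :
  (forall x x', `|f x - f x'| <= C * `|x - x'|) -> (forall x, `|f x| <= N) ->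
  potential nu (cut (spt nu) f).
Proof.
move=> lf fN; split; first by move=> x; rewrite /cut; case: ifP.
have intf := bounded_lipschitz_integrable nu lf fN.
have mf := continuous_rV_measurable (lipschitz_is_continuous lf).
apply/integrableP; split; first exact: cut_measurable.
have /integrableP[_] := intf; apply: le_lt_trans.
rewrite le_eqVlt; apply/orP; left; apply/eqP; apply: ae_eq_integral => //.
- by apply: measurableT_comp => //; exact: cut_measurable.
- by apply: measurableT_comp => //; exact/measurable_EFinP.
- by apply: ae_spt => x Kx _; rewrite /cut mem_set.
Qed.

Lemma good_pair_feasible N f g : good_pair N f g ->
  dual_feasible c rho mu (cut K f) (cut L g).
Proof.
move=> [lf lg fM gM fgk]; split; [exact: cut_potential lf fM|exact: cut_potential lg gM|].
move=> x y; rewrite /cut; case: ifP => [/set_mem Kx|_]; last by rewrite leNye.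
case: ifP => [/set_mem Ly|_]; last by rewrite addeNy leNye.
by rewrite -EFinD lee_fin -kc// fgk.
Qed.

Definition pair_value (f g : X -> R) : R :=
  \int[rho]_x f x + \int[mu]_y g y.

Lemma good_pair_value N f g : good_pair N f g ->
  dual_value rho mu (cut K f) (cut L g) = (pair_value f g)%:E.
Proof.
move=> [lf lg fM gM fgk].
have intf := bounded_lipschitz_integrable rho lf fM.
have intg := bounded_lipschitz_integrable mu lg gM.
have mf := continuous_rV_measurable (lipschitz_is_continuous lf).
have mg := continuous_rV_measurable (lipschitz_is_continuous lg).
rewrite /dual_value !cut_integral// /pair_value EFinD /Rintegral.
by rewrite !fineK//; exact: integrable_fin_num.
Qed.

Lemma potential_le_integral (nu : probability X R) (phi : X -> \bar R) (f : X -> R)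
    (N l : R) : potential nu phi ->
  (forall x x', `|f x - f x'| <= C * `|x - x'|) -> (forall x, `|f x| <= N) ->
  (forall x, spt nu x -> (phi x <= (f x + l)%:E)%E) ->
  (\int[nu]_x phi x <= (\int[nu]_x f x + l)%:E)%E.
Proof.
move=> [_ intphi] lf fN phif.
have intf := bounded_lipschitz_integrable nu lf fN.
have intl : nu.-integrable setT (EFin \o cst l).
  exact: finite_measure_integrable_cst.
have -> : \int[nu]_x f x + l = \int[nu]_x (f x + l).
  have nuT : fine (nu setT) = 1 by rewrite probability_setT.
  rewrite RintegralD// Rintegral_cst//; congr (_ + _).
  by rewrite -[LHS]mulr1; congr (_ * _).
have intfl : nu.-integrable setT (EFin \o (fun x => f x + l)).
  exact: (integrableD measurableT intf intl).
rewrite /Rintegral fineK; last exact: integrable_fin_num.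
have mS : measurable (~` spt nu) by apply: measurableC; exact: spt_measurable.
have S0 : nu (~` spt nu) = 0%E by exact: rV_spt_setC_null.
rewrite (negligible_integral mS _ intphi)// (negligible_integral mS _ intfl)//.
have mD : measurable (setT `\` ~` spt nu) by exact: measurableD.
apply: le_integral => //.
- exact: integrableS intphi.
- exact: integrableS intfl.
- by move=> x /set_mem[_ /contrapT]; exact: phif.
Qed.

Lemma potential_fin (nu : probability X R) (phi : X -> \bar R) : potential nu phi ->
  exists2 x, spt nu x & phi x \is a fin_num.
Proof.
move=> [phioo intphi]; apply: contrapT => H.
have : {ae nu, forall x, setT x -> phi x \is a fin_num}.
  exact: integrable_ae.
move=> [N [mN N0 HN]].
have := spt_probability nu.
suff -> : nu (spt nu) = 0%E by move=> /esym/eqP; rewrite onee_eq0.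
apply: (subset_measure0 (spt_measurable nu) mN) => // x Kx.
by apply: HN => /= /(_ I) fx; apply: H; exists x.
Qed.

(** The shifts [l] and [- l] cancel in the dual value because [rho] and [mu] both have mass 1. *)
Lemma dual_feasible_improvement phi psi : dual_feasible c rho mu phi psi ->
  exists f g l, [/\ good_pair (3 * M) f g,
    forall x, K x -> (phi x <= (f x + l)%:E)%E,
    forall y, L y -> (psi y <= (g y - l)%:E)%E &
    (dual_value rho mu phi psi <= (pair_value f g)%:E)%E].
Proof.
move=> [pphi ppsi phipsi].
have [|||||f [g [l [gfg phif psig]]]] := @c_transform_improvement phi psi.
- by case: pphi.
- by case: ppsi.
- by move=> x y Kx Ly; rewrite kc.
- exact: potential_fin.
- exact: potential_fin.
exists f, g, l; split => //; case: gfg => [lf lg fM gM _].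
have := leeD (potential_le_integral pphi lf fM phif)
             (potential_le_integral ppsi lg gM psig).
by rewrite -EFinD /pair_value [X in (_ <= X%:E)%E](_ : _ = pair_value f g)// /pair_value; ring.
Qed.
End kantorovich.

(** * Existence of dual maximisers *)

(** Compactness provides a cluster point, and along an ultrafilter a cluster point is a limit. One
    ultrafilter thus gives limits at all points of space at once, in place of a diagonal
    extraction. *)
Lemma ultrafilter_bounded_cvg (R : realType) (T : Type) (U : set_system T)
    (u : T -> R) (N : R) : UltraFilter U -> (forall n, `|u n| <= N) ->
  exists p, forall e, 0 < e -> \forall n \near U, `|u n - p| < e.
Proof.
move=> UU uN.
have UP : ProperFilter U by exact: ultra_proper.
have cN : compact `[- N, N]%classic := @segment_compact R (- N) N.
have [|p [_ clp]] := cN (u @ U) _.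
  by apply: (@filterE _ U) => n /=; rewrite in_itv/= -ler_norml; exact: uN.
exists p => e e0.
have [//|H] := in_ultra_setVsetC [set n | `|u n - p| < e] UU.
have [||y [H1 H2]] := clp [set y | ~ (`|y - p| < e)] (ball p e).
- exact: H.
- exact: nbhsx_ballx.
by exfalso; apply: H1; rewrite distrC; exact: H2.
Qed.

Section dual_existence.
Context (R : realType) (d : nat).
Local Notation X := 'rV[R]_d.
Context (c : X * X -> R) (rho mu : probability X R).
Context (k : X -> X -> R) (C M : R).
Hypothesis lk : lipschitz_cost C M k.
Local Notation K := (spt rho).
Local Notation L := (spt mu).
Hypothesis kc : forall x y, K x -> L y -> k x y = c (x, y).

Lemma integral_le_shift (nu : probability X R) (f p : X -> R) (N l : R) :
  (forall x x', `|f x - f x'| <= C * `|x - x'|) -> (forall x, `|f x| <= N) ->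
  (forall x x', `|p x - p x'| <= C * `|x - x'|) -> (forall x, `|p x| <= N) ->
  (forall x, spt nu x -> f x <= p x + l) ->
  \int[nu]_x f x <= \int[nu]_x p x + l.
Proof.
move=> lf fN lp pN fp.
have intf := bounded_lipschitz_integrable nu lf fN.
have pf : potential nu (EFin \o f) by [].
have fp' x : spt nu x -> ((EFin \o f) x <= (p x + l)%:E)%E.
  by move=> /fp; rewrite lee_fin.
have := potential_le_integral pf lp pN fp'.
rewrite -lee_fin; apply: le_trans; rewrite /Rintegral fineK//.
exact: integrable_fin_num.
Qed.

Lemma equilipschitz_uniform_cvg (T : Type) (U : set_system T)
    (f : T -> X -> R) (p : X -> R) (S : set X) (e : R) : Filter U -> compact S ->
  (forall n x x', `|f n x - f n x'| <= C * `|x - x'|) ->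
  (forall x x', `|p x - p x'| <= C * `|x - x'|) ->
  (forall x e, 0 < e -> \forall n \near U, `|f n x - p x| < e) -> 0 < e ->
  \forall n \near U, forall x, S x -> `|f n x - p x| <= e.
Proof.
case: lk => C0 _ _ _ _ UF /compact_near_coveringP cS lf lp fp e0.
pose P n x := `|f n x - p x| <= e.
have := cS _ U P UF; apply => x Sx.
have C1 : 0 < C + 1 by rewrite ltr_wpDl.
(* On a ball of this radius [f n] and [p] each vary by at most [e / 4], which leaves [e / 2] for the
   error at the centre; [C + 1] is positive even when [C = 0]. *)
have r0 : 0 < e / 4 / (C + 1) by rewrite !divr_gt0.
have e2 : 0 < e / 2 by rewrite divr_gt0.
exists (ball x (e / 4 / (C + 1)), [set n | `|f n x - p x| < e / 2]).
  by split; [exact: nbhsx_ballx|exact: fp].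
move=> [x' n] /= [xx' fn]; rewrite /P.
have Cxx' : C * `|x - x'| <= e / 4.
  apply: (@le_trans _ _ ((C + 1) * `|x - x'|)); first by rewrite ler_wpM2r// lerDl.
  rewrite -ler_pdivlMl// mulrC ltW//.
  by move: xx'; rewrite -ball_normE.
have -> : f n x' - p x' = (f n x - p x) + ((p x - p x') - (f n x - f n x')) by ring.
apply: le_trans (ler_normD _ _) _.
have := ler_normB (p x - p x') (f n x - f n x').
have := lf n x x'; have := lp x x'; lra.
Qed.

Lemma maximal_good_pair : compact K -> compact L ->
  exists p q, good_pair rho mu k C (3 * M) p q /\
    forall f g, good_pair rho mu k C (3 * M) f g ->
      pair_value rho mu f g <= pair_value rho mu p q.
Proof.
move=> cK cL; case: (lk) => C0 M0 kM _ _.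
pose good f g := good_pair rho mu k C (3 * M) f g.
pose E := [set v | exists f g, good f g /\ v = pair_value rho mu f g].
have cst_lip (a : R) (x x' : X) : `|(fun=> a) x - (fun=> a) x'| <= C * `|x - x'|.
  by rewrite subrr normr0 mulr_ge0.
(* This pair shows that the set [E] of values is nonempty, so that its supremum is meaningful. *)
have good0 : good (fun=> 0) (fun=> - M).
  split; [exact: cst_lip|exact: cst_lip| | |].
  - by move=> x; rewrite normr0 mulr_ge0.
  - by move=> x; rewrite normrN ger0_norm//; lra.
  - by move=> x y _ _; have := kM x y; rewrite ler_norml add0r => /andP[].
have ubE : ubound E (6 * M).
  move=> _ [f [g [[lf lg fM gM _] ->]]].
  have zM (x : X) : `|(fun=> 0 : R) x| <= 3 * M by rewrite normr0 mulr_ge0.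
  have bnd (nu : probability X R) (h : X -> R) :
      (forall x x', `|h x - h x'| <= C * `|x - x'|) ->
      (forall x, `|h x| <= 3 * M) -> \int[nu]_x h x <= 3 * M.
    move=> lh hM.
    have := integral_le_shift (l := 3 * M) lh hM (cst_lip 0) zM.
    move=> /(_ nu); rewrite Rintegral_cst// mul0r add0r; apply => x _.
    exact: le_trans (ler_norm _) (hM x).
  have -> : 6 * M = 3 * M + 3 * M by ring.
  by apply: lerD; exact: bnd.
have supE : has_sup E.
  split; last by exists (6 * M).
  by exists (pair_value rho mu (fun=> 0) (fun=> - M)), (fun=> 0), (fun=> - M).
have /choice[fg fgP] : forall n : nat, exists fg : (X -> R) * (X -> R),
    good fg.1 fg.2 /\ sup E - n.+1%:R^-1 < pair_value rho mu fg.1 fg.2.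
  move=> n; have n0 : 0 < n.+1%:R^-1 :> R by rewrite invr_gt0.
  have [_ [f [g [gfg ->]]] H] := sup_adherent n0 supE.
  by exists (f, g).
(* [U] refines the filter of cofinite sets of indices, so [1/(n+1)] still becomes small along it. *)
have [U [UU Uoo]] := ultraFilterLemma (@eventually_filter : ProperFilter \oo).
have UP : ProperFilter U by exact: ultra_proper.
have /choice[p pP] : forall x, exists p, forall e, 0 < e ->
    \forall n \near U, `|(fg n).1 x - p| < e.
  move=> x; apply: (@ultrafilter_bounded_cvg _ _ _ _ (3 * M)) => n.
  by have [[_ _ fM _ _] _] := fgP n; exact: fM.
have /choice[q qP] : forall x, exists p, forall e, 0 < e ->
    \forall n \near U, `|(fg n).2 x - p| < e.
  move=> x; apply: (@ultrafilter_bounded_cvg _ _ _ _ (3 * M)) => n.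
  by have [[_ _ _ gM _] _] := fgP n; exact: gM.
have lim_lip (h : nat -> X -> R) (r : X -> R) :
    (forall x e, 0 < e -> \forall n \near U, `|h n x - r x| < e) ->
    (forall n x x', `|h n x - h n x'| <= C * `|x - x'|) ->
    forall x x', `|r x - r x'| <= C * `|x - x'|.
  move=> hr hl x x'; apply/ler_addgt0Pr => e e0.
  have e2 : 0 < e / 2 by rewrite divr_gt0.
  have [n [n1 n2]] := filter_ex (filterI (hr x _ e2) (hr x' _ e2)).
  have := hl n x x'; rewrite ler_norml => /andP[? ?].
  move: n1 n2; rewrite /= !ltr_norml => /andP[? ?] /andP[? ?].
  by rewrite ler_norml; apply/andP; split; lra.
have lim_bnd (h : nat -> X -> R) (r : X -> R) :
    (forall x e, 0 < e -> \forall n \near U, `|h n x - r x| < e) ->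
    (forall n x, `|h n x| <= 3 * M) -> forall x, `|r x| <= 3 * M.
  move=> hr hM x; apply/ler_addgt0Pr => e e0.
  have [n n1] := filter_ex (hr x _ e0).
  have := hM n x; rewrite ler_norml => /andP[? ?].
  move: n1; rewrite /= !ltr_norml => /andP[? ?].
  by rewrite ler_norml; apply/andP; split; lra.
have fl n : forall x x', `|(fg n).1 x - (fg n).1 x'| <= C * `|x - x'|.
  by have [[]] := fgP n.
have gl n : forall x x', `|(fg n).2 x - (fg n).2 x'| <= C * `|x - x'|.
  by have [[]] := fgP n.
have fM n : forall x, `|(fg n).1 x| <= 3 * M by have [[]] := fgP n.
have gM n : forall x, `|(fg n).2 x| <= 3 * M by have [[]] := fgP n.
have lp := lim_lip (fun n => (fg n).1) p pP fl.
have lq := lim_lip (fun n => (fg n).2) q qP gl.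
have pM := lim_bnd (fun n => (fg n).1) p pP fM.
have qM := lim_bnd (fun n => (fg n).2) q qP gM.
exists p, q; split.
  split => // x y Kx Ly; apply/ler_addgt0Pr => e e0.
  have e2 : 0 < e / 2 by rewrite divr_gt0.
  have [n [n1 n2]] := filter_ex (filterI (pP x _ e2) (qP y _ e2)).
  have [[_ _ _ _ /(_ x y Kx Ly) ?] _] := fgP n.
  move: n1 n2; rewrite /= !ltr_norml => /andP[? ?] /andP[? ?].
  lra.
move=> f g gfg; apply: (@le_trans _ _ (sup E)).
  by apply: sup_upper_bound => //; exists f, g.
(* One third of [e] covers each of three errors: the uniform ones on [K] and on [L], and the defect
   of the [n]-th pair from the supremum. *)
apply/ler_addgt0Pr => e e0; have e3 : 0 < e / 3 by rewrite divr_gt0.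
have UF : Filter U by typeclasses eauto.
have uf := equilipschitz_uniform_cvg UF cK fl lp pP e3.
have ug := equilipschitz_uniform_cvg UF cL gl lq qP e3.
have un : \forall n \near U, n.+1%:R^-1 < e / 3.
  by apply: Uoo; exact: near_infty_natSinv_lt (PosNum e3).
have [n [[n1 n2] n3]] := filter_ex (filterI (filterI uf ug) un).
have [_ vn] := fgP n.
have vf : \int[rho]_x (fg n).1 x <= \int[rho]_x p x + e / 3.
  apply: integral_le_shift (fl n) (fM n) lp pM _ => x Kx.
  by have := n1 x Kx; rewrite ler_norml => /andP[? ?]; lra.
have vg : \int[mu]_x (fg n).2 x <= \int[mu]_x q x + e / 3.
  apply: integral_le_shift (gl n) (gM n) lq qM _ => x Lx.
  by have := n2 x Lx; rewrite ler_norml => /andP[? ?]; lra.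
have {vn vf vg} := lt_le_trans vn (lerD vf vg).
move: n3 => /=; rewrite /pair_value.
set r := n.+1%:R^-1; set P := Rintegral _ _ _; set Q := Rintegral _ _ _.
move: r P Q (sup E) => r P Q s; lra.
Qed.

(** Maximality among good pairs is enough, since every feasible pair is dominated in value by a good
    one. *)
Lemma dual_optimal_exists : compact K -> compact L ->
  exists p q, good_pair rho mu k C (3 * M) p q /\
    dual_optimal c rho mu (cut K p) (cut L q).
Proof.
move=> cK cL; have [p [q [gpq pq_max]]] := maximal_good_pair cK cL.
exists p, q; split => //; split; first exact: (good_pair_feasible kc gpq).
move=> phi psi /(dual_feasible_improvement lk kc)[f [g [l [gfg _ _ /le_trans]]]].
by apply; rewrite (good_pair_value gpq) lee_fin; exact: pq_max.
Qed.
End dual_existence.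

(** * Couplings *)

Section coupling.
Context (R : realType) (d : nat).
Local Notation X := 'rV[R]_d.
Context (rho mu : probability X R) (gamma : probability (X * X)%type R).
Hypothesis cg : coupling rho mu gamma.

Lemma coupling_spt z : spt gamma z -> spt rho z.1 /\ spt mu z.2.
Proof.
case: cg => gfst gsnd sz; split => U oU Uz.
  rewrite -gfst; last exact: open_rV_measurable.
  by apply: sz => //; apply: open_comp => // y _; exact: cvg_fst.
rewrite -gsnd; last exact: open_rV_measurable.
by apply: sz => //; apply: open_comp => // y _; exact: cvg_snd.
Qed.

Lemma rV2_spt_measurable : measurable (spt gamma).
Proof.
rewrite -(setCK (spt gamma)); apply: measurableC; apply: open_rV2_measurable.
by apply: closed_openC; exact: closed_spt.
Qed.

Lemma ae_rV2_spt (P : X * X -> Prop) :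
  (forall z, spt gamma z -> P z) -> {ae gamma, forall z, P z}.
Proof.
move=> H; exists (~` spt gamma); split.
- by apply: measurableC; exact: rV2_spt_measurable.
- exact: rV2_spt_setC_null.
- by move=> x /=; apply: contra_not; exact: H.
Qed.

Lemma compact_spt_coupling : compact (spt rho) -> compact (spt mu) ->
  compact (spt gamma).
Proof.
move=> cK cL; apply: subclosed_compact (compact_setX cK cL) _.
  exact: closed_spt.
by move=> z /coupling_spt[].
Qed.

(** The image of the compact set [spt gamma] under [p] is closed, and its complement is an open
    [nu]-null set, which cannot meet [spt nu]. A general [p] covers both projections. *)
Lemma coupling_fiber (nu : probability X R) (p : X * X -> X) x :
  compact (spt rho) -> compact (spt mu) -> continuous p ->
  measurable_fun setT p ->
  (forall A, measurable A -> gamma (p @^-1` A) = nu A) -> spt nu x ->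
  exists2 z, spt gamma z & p z = x.
Proof.
move=> cK cL cp mp gp Kx; have cS := compact_spt_coupling cK cL.
have clF : closed (p @` spt gamma).
  apply: compact_closed; first exact: norm_hausdorff.
  by apply: continuous_compact => //; exact: continuous_subspaceT.
have mF := open_rV_measurable (closed_openC clF).
apply: contrapT => H.
have xF : (~` (p @` spt gamma)) x by move=> [z sz pz]; apply: H; exists z.
have := Kx _ (closed_openC clF) xF; rewrite -gp//.
rewrite (subset_measure0 _ _ _ (rV2_spt_setC_null gamma)) ?ltxx//.
- by rewrite -[X in measurable X]setTI; exact: mp.
- by apply: measurableC; exact: rV2_spt_measurable.
- by move=> z /= zF sz; apply: zF; exists z.
Qed.

Lemma coupling_fiber_fst x : compact (spt rho) -> compact (spt mu) ->
  spt rho x -> exists y, spt gamma (x, y).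
Proof.
move=> cK cL Kx; case: cg => gfst _.
have [|[x' y] sz <-] := coupling_fiber cK cL _ measurable_fst gfst Kx.
  by move=> z; exact: cvg_fst.
by exists y.
Qed.

Lemma coupling_fiber_snd y : compact (spt rho) -> compact (spt mu) ->
  spt mu y -> exists x, spt gamma (x, y).
Proof.
move=> cK cL Ly; case: cg => _ gsnd.
have [|[x y'] sz <-] := coupling_fiber cK cL _ measurable_snd gsnd Ly.
  by move=> z; exact: cvg_snd.
by exists x.
Qed.

Lemma integral_marginal (nu : probability X R) (p : X * X -> X) (f : X -> R) :
  measurable_fun setT p ->
  (forall A, measurable A -> gamma (p @^-1` A) = nu A) ->
  continuous f -> (exists N, forall x, `|f x| <= N) ->
  gamma.-integrable setT (EFin \o (f \o p)) /\
  \int[gamma]_z f (p z) = \int[nu]_x f x.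
Proof.
move=> mp gp cf [N fN]; have mf := continuous_rV_measurable cf.
have intfp : gamma.-integrable setT (EFin \o (f \o p)).
  apply: measurable_bounded_integrable => //.
  - by rewrite (le_lt_trans (probability_le1 gamma measurableT))// ltry.
  - exact: measurableT_comp.
  - exists N; split; first exact: num_real.
    by move=> r Nr x _; rewrite /= (le_trans (fN _))// ltW.
split => //; rewrite /Rintegral; congr fine.
have mEf : measurable_fun setT (EFin \o f) by exact/measurable_EFinP.
transitivity (\int[pushforward gamma p]_x (f x)%:E)%E.
  by rewrite (integral_pushforward mp mEf)// preimage_setT.
by apply: eq_measure_integral => A mA _; exact: gp.
Qed.
End coupling.

(** * Cyclical monotonicity *)

Definition cyclic_succ (n i : nat) : nat := if i.+1 == n then 0%N else i.+1.

Lemma sum_cyclic_succ (R : nmodType) (n : nat) (F : nat -> R) :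
  \sum_(i < n) F (cyclic_succ n i) = \sum_(i < n) F i.
Proof.
case: n => [|n]; first by rewrite !big_ord0.
rewrite big_ord_recr big_ord_recl /= /cyclic_succ eqxx addrC; congr (_ + _).
by apply: eq_bigr => i _; rewrite eqSS ltn_eqF.
Qed.

Section duality.
Context (R : realType) (d : nat).
Local Notation X := 'rV[R]_d.
Context (c : X * X -> R) (rho mu : probability X R).
Context (k : X -> X -> R) (C M : R).
Hypothesis lk : lipschitz_cost C M k.
Local Notation K := (spt rho).
Local Notation L := (spt mu).
Hypothesis kc : forall x y, K x -> L y -> k x y = c (x, y).
Hypothesis cc : continuous c.
Context (gamma : probability (X * X)%type R).
Local Notation kk := (fun z : X * X => k z.1 z.2).

Lemma cost_lipschitz z z' : `|kk z - kk z'| <= (2 * C) * `|z - z'|.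
Proof.
case: lk => C0 _ _ lx ly.
have -> : kk z - kk z' = (k z.1 z.2 - k z'.1 z.2) + (k z'.1 z.2 - k z'.1 z'.2).
  by ring.
apply: le_trans (ler_normD _ _) _.
have -> : 2 * C * `|z - z'| = C * `|z - z'| + C * `|z - z'| by ring.
apply: lerD.
  apply: le_trans (lx _ _ _) _; rewrite ler_wpM2l//.
  by rewrite prod_normE/= le_max lexx.
apply: le_trans (ly _ _ _) _; rewrite ler_wpM2l//.
by rewrite prod_normE/= le_max lexx orbT.
Qed.

Lemma cost_continuous : continuous kk.
Proof. exact: lipschitz_is_continuous cost_lipschitz. Qed.

Lemma cost_integrable (g : probability (X * X)%type R) :
  g.-integrable setT (EFin \o kk).
Proof.
case: lk => C0 M0 kM _ _; apply: measurable_bounded_integrable => //.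
- by rewrite (le_lt_trans (probability_le1 g measurableT))// ltry.
- by apply: continuous_rV2_measurable; exact: cost_continuous.
- exists M; split; first exact: num_real.
  by move=> r Mr x _; rewrite /= (le_trans (kM _ _))// ltW.
Qed.

Lemma coupling_cost_integral (g : probability (X * X)%type R) :
  coupling rho mu g -> (\int[g]_z (c z)%:E = (\int[g]_z kk z)%:E)%E.
Proof.
move=> cg; rewrite /Rintegral fineK; last first.
  by apply: integrable_fin_num => //; exact: cost_integrable.
apply: ae_eq_integral => //.
- by apply/measurable_EFinP; exact: continuous_rV2_measurable.
- by apply/measurable_EFinP; apply: continuous_rV2_measurable; exact: cost_continuous.
- apply: ae_rV2_spt => z sz _; have [Kz Lz] := coupling_spt cg sz.
  by rewrite kc//; case: z {sz Kz Lz}.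
Qed.

Lemma optimal_cyclically_monotone (n : nat) (z : nat -> X * X) :
  optimal_plan c rho mu gamma -> (0 < n)%N -> (forall i, spt gamma (z i)) ->
  \sum_(i < n) kk (z i) <= \sum_(i < n) k (z (cyclic_succ n i)).1 (z i).2.
Proof.
move=> [cg gmin] n0 sz; case: (lk) => C0 M0 kM lx ly.
rewrite leNgt; apply/negP => lt_sum.
pose Delta := \sum_(i < n) kk (z i) - \sum_(i < n) k (z (cyclic_succ n i)).1 (z i).2.
have Delta0 : 0 < Delta by rewrite subr_gt0.
have C1 : 0 < C + 1 by rewrite ltr_wpDl.
have nR : 0 < n%:R :> R by rewrite ltr0n.
(* The oscillation error [4 * C * r] arises in each of [n] terms; with this radius the total is
   [Delta * C / (C + 1)], below [Delta]. *)
pose r := Delta / (4 * (C + 1) * n%:R).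
have r0 : 0 < r by rewrite divr_gt0// !mulr_gt0.
(* The shift makes the cost nonnegative, as the exchange lemma requires, and absorbs the oscillation
   on the balls: [k + N] is at least [kk (z i) + M >= 0] on the [i]-th rectangle. *)
pose N := M + 2 * C * r.
pose h z := kk z + N.
pose S i := ball (z i).1 r.
pose U i := ball (z i).2 r.
have near_k x x' y y' : ball x r x' -> ball y r y' ->
    `|k x y - k x' y'| <= 2 * C * r.
  rewrite -ball_normE /ball_/= => xr yr.
  have -> : k x y - k x' y' = (k x y - k x' y) + (k x' y - k x' y') by ring.
  apply: le_trans (ler_normD _ _) _.
  have -> : 2 * C * r = C * r + C * r by ring.
  apply: lerD.
    by apply: le_trans (lx _ _ _) _; rewrite ler_wpM2l// ltW.
  by apply: le_trans (ly _ _ _) _; rewrite ler_wpM2l// ltW.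
have [|||||||||||g [gfst gsnd lt_int]] := @cyclic_competitor R _ _ X X gamma h
    (M + N) n (cyclic_succ n) S U (fun i => kk (z i) + M)
    (fun i => k (z (cyclic_succ n i)).1 (z i).2 + M + 4 * C * r).
- apply: continuous_rV2_measurable => y.
  by apply: cvgD; [exact: cost_continuous|exact: cvg_cst].
- move=> w; have := kM w.1 w.2; rewrite ler_norml /h /N => /andP[? ?].
  have Cr : 0 <= C * r by rewrite mulr_ge0// ltW.
  by apply/andP; split; lra.
- exact: n0.
- by move=> i; apply: open_rV_measurable; exact: ball_open.
- by move=> i; apply: open_rV_measurable; exact: ball_open.
- move=> i; apply: (sz i); last by split; exact: ballxx.
  rewrite openE => w [w1 w2]; exists (S i, U i); last by [].
  by split; apply: open_nbhs_nbhs; split => //; exact: ball_open.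
- by move=> i; have := kM (z i).1 (z i).2; rewrite ler_norml => /andP[? ?]; lra.
- move=> i w [w1 w2]; have := near_k _ _ _ _ w1 w2.
  by rewrite ler_norml /h /N => /andP[? ?]; lra.
- move=> i w [w1 w2]; have := near_k _ _ _ _ w1 w2.
  by rewrite ler_norml /h /N => /andP[? ?]; lra.
- exact: (@sum_cyclic_succ (\bar R)).
- have sumc (a : nat -> R) t : \sum_(i < n) (a i + t) = \sum_(i < n) a i + t * n%:R.
    by rewrite big_split/= sumr_const card_ord mulr_natr.
  rewrite (sumc (fun i => k (z (cyclic_succ n i)).1 (z i).2 + M)).
  rewrite (sumc (fun i => k (z (cyclic_succ n i)).1 (z i).2)).
  rewrite (sumc (fun i => kk (z i))).
  have Crn : 4 * C * r * n%:R < Delta.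
    have -> : 4 * C * r * n%:R = Delta * (C / (C + 1)).
      by rewrite /r; field; rewrite !gt_eqF.
    by rewrite gtr_pMr// ltr_pdivrMr// mul1r ltrDl.
  by move: Crn; rewrite /Delta; lra.
have cg' : coupling rho mu g.
  by case: cg => H1 H2; split => A mA; rewrite ?gfst ?gsnd ?H1 ?H2.
have := gmin _ cg'; rewrite !coupling_cost_integral// lee_fin.
(* Mass 1 turns the shift into the same constant [N] for both plans, so it drops out of the
   comparison. *)
have hE (P : probability (X * X)%type R) :
    (\int[P]_w (h w)%:E = (\int[P]_w kk w + N)%:E)%E.
  have intN : P.-integrable setT (EFin \o cst N).
    exact: finite_measure_integrable_cst.
  have PT : fine (P setT) = 1 by rewrite probability_setT.
  have -> : \int[P]_w kk w + N = \int[P]_w (kk w + N).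
    rewrite RintegralD//; last exact: cost_integrable.
    congr (_ + _); rewrite Rintegral_cst//.
    by rewrite -[LHS]mulr1; congr (_ * _).
  rewrite /Rintegral fineK//; apply: integrable_fin_num => //.
  exact: (integrableD measurableT (cost_integrable P) intN).
move: lt_int; rewrite !hE lte_fin ltrD2r => lt_int.
by rewrite leNgt lt_int.
Qed.

(* G x is the infimum of the cost increments along chains of points of spt gamma
   that start at a fixed z0 and end at x. *)
Lemma rockafellar_potential : optimal_plan c rho mu gamma ->
  exists G : X -> R, [/\ forall x x', `|G x - G x'| <= C * `|x - x'|,
    forall x x', `|G x - G x'| <= 2 * M &
    forall q x, spt gamma q -> G x <= G q.1 + (k x q.2 - kk q)].
Proof.
move=> og; case: (lk) => C0 M0 kM lx ly.
have [z0 sz0] : spt gamma !=set0.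
  apply/set0P/eqP => s0.
  have : gamma setT = 0%E by rewrite -setC0 -s0; exact: rV2_spt_setC_null.
  by rewrite probability_setT => /eqP; rewrite onee_eq0.
(* A chain is an index of its last point with a total sequence in the support; entries beyond that
   index do not enter [F]. *)
pose S : set (nat * (nat -> X * X)) :=
  [set nz | nz.2 0%N = z0 /\ forall i, spt gamma (nz.2 i)].
pose F (nz : nat * (nat -> X * X)) x :=
  \sum_(i < nz.1) (k (nz.2 i.+1).1 (nz.2 i).2 - kk (nz.2 i)) +
  (k x (nz.2 nz.1).2 - kk (nz.2 nz.1)).
have FB nz x x' : F nz x - F nz x' = k x (nz.2 nz.1).2 - k x' (nz.2 nz.1).2.
  by rewrite /F; ring.
have [||||G [GF Gm GC GN]] := @inf_of_equilipschitz _ X _ S F C (2 * M).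
- by exists (0%N, fun=> z0).
- by move=> nz x x' _; rewrite FB.
- move=> nz x x' _; rewrite FB; apply: le_trans (ler_normB _ _) _.
  by rewrite (_ : 2 * M = M + M) ?lerD//; ring.
(* At [x = z0.1] the chain closes up to a cycle, so cyclical monotonicity bounds its cost increment
   below by 0. *)
- exists z0.1, 0 => -[n z] [/= z00 sz].
  have := optimal_cyclically_monotone og (ltn0Sn n) sz.
  rewrite -subr_ge0 -sumrB big_ord_recr/= {2}/cyclic_succ eqxx z00.
  rewrite /F/=; congr (0 <= _ + _); apply: eq_bigr => i _.
  by rewrite /cyclic_succ eqSS ltn_eqF.
exists G; split => // q x sq.
suff : G x - (k x q.2 - kk q) <= G q.1 by lra.
apply: Gm => -[n z] [/= z00 sz].
(* Appending [q] to a chain ending at [q.1] gives a chain ending at [x]. *)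
pose z' i := if (i <= n)%N then z i else q.
have Sz' : S (n.+1, z').
  by split => [|i]; rewrite /z'//=; case: ifP.
have := GF _ x Sz'; rewrite {1}/F/= big_ord_recr/=.
have z'n : z' n = z n by rewrite /z' leqnn.
have z'q : z' n.+1 = q by rewrite /z' ltnn.
rewrite !z'n !z'q.
have -> : \sum_(i < n) (k (z' i.+1).1 (z' i).2 - k (z' i).1 (z' i).2) =
    \sum_(i < n) (k (z i.+1).1 (z i).2 - k (z i).1 (z i).2).
  by apply: eq_bigr => i _; rewrite /z' ltn_ord ltnW.
by rewrite /F/=; lra.
Qed.
End duality.

(** * Complementary slackness *)

Section complementary_slackness.
Context (R : realType) (d : nat).
Local Notation X := 'rV[R]_d.
Context (c : X * X -> R) (rho mu : probability X R).
Context (k : X -> X -> R) (C M : R).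
Hypothesis lk : lipschitz_cost C M k.
Local Notation K := (spt rho).
Local Notation L := (spt mu).
Hypothesis kc : forall x y, K x -> L y -> k x y = c (x, y).
Hypothesis cc : continuous c.
Context (gamma : probability (X * X)%type R).
Hypothesis og : optimal_plan c rho mu gamma.
Local Notation kk := (fun z : X * X => k z.1 z.2).

Lemma le_Rintegral_spt (f g : X * X -> R) :
  gamma.-integrable setT (EFin \o f) -> gamma.-integrable setT (EFin \o g) ->
  (forall z, spt gamma z -> f z <= g z) ->
  \int[gamma]_z f z <= \int[gamma]_z g z.
Proof.
move=> intf intg fg.
have mS := rV2_spt_measurable gamma.
have mSC : measurable (~` spt gamma) by exact: measurableC.
have S0 : gamma (~` spt gamma) = 0%E by exact: rV2_spt_setC_null.
have E (h : X * X -> R) : gamma.-integrable setT (EFin \o h) ->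
    \int[gamma]_z h z = \int[gamma]_(z in spt gamma) h z.
  move=> inth; rewrite /Rintegral (negligible_integral mSC _ inth)//.
  by congr (fine (integral _ _ _)); rewrite setTD setCK.
rewrite !E//; apply: le_Rintegral => //.
- exact: integrableS intf.
- exact: integrableS intg.
Qed.

Lemma good_pair_integral N f g : good_pair rho mu k C N f g ->
  gamma.-integrable setT (EFin \o (fun z => f z.1 + g z.2)) /\
  \int[gamma]_z (f z.1 + g z.2) = pair_value rho mu f g.
Proof.
move=> [lf lg fN gN _]; case: og => -[gfst gsnd] _.
have cf := lipschitz_is_continuous lf; have cg := lipschitz_is_continuous lg.
have [if_ Ef] := integral_marginal (@measurable_fst _ _ X X) gfst cf (ex_intro _ N fN).
have [ig Eg] := integral_marginal (@measurable_snd _ _ X X) gsnd cg (ex_intro _ N gN).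
split; first exact: (integrableD measurableT if_ ig).
by rewrite RintegralD// /pair_value -Ef -Eg.
Qed.

(** [H] is the c-transform of Rockafellar's potential [G]. The defining inequality of [G] gives
    [H z.2 >= kk z - G z.1] on [spt gamma]; integrating it against [gamma] bounds the cost by the
    dual value. *)
Lemma no_duality_gap : exists phi psi, dual_feasible c rho mu phi psi /\
  ((\int[gamma]_z kk z)%:E <= dual_value rho mu phi psi)%E.
Proof.
have [G [GC GM Gq]] := rockafellar_potential lk kc cc og.
case: (lk) => C0 M0 kM lx ly.
have [z0 sz0] : spt gamma !=set0.
  apply/set0P/eqP => s0.
  have : gamma setT = 0%E by rewrite -setC0 -s0; exact: rV2_spt_setC_null.
  by rewrite probability_setT => /eqP; rewrite onee_eq0.
have [||||H [HF Hm HC HM]] :=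
    @inf_of_equilipschitz R X X setT (fun x y => k x y - G x) C (2 * M).
- by exists z0.1.
- move=> x y y' _ /=.
  by have -> : k x y - G x - (k x y' - G x) = k x y - k x y' by ring.
- move=> x y y' _ /=.
  have -> : k x y - G x - (k x y' - G x) = k x y - k x y' by ring.
  apply: le_trans (ler_normB _ _) _.
  by rewrite (_ : 2 * M = M + M) ?lerD//; ring.
- by exists z0.2, (kk z0 - G z0.1) => x _; have := Gq _ x sz0; lra.
(* The potentials are not normalised here, so their bound comes from the values at [z0] and the
   oscillation [2 * M]. *)
pose N := `|G z0.1| + `|H z0.2| + 2 * M.
have gGH : good_pair rho mu k C N G H.
  split => //.
  - move=> x; have := ler_normD (G x - G z0.1) (G z0.1); rewrite subrK /N.
    by have := normr_ge0 (H z0.2); have := GM x z0.1; lra.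
  - move=> x; have := ler_normD (H x - H z0.2) (H z0.2); rewrite subrK /N.
    by have := normr_ge0 (G z0.1); have := HM x z0.2; lra.
  - by move=> x y _ _; have := HF x y I; lra.
exists (cut K G), (cut L H); split; first exact: (good_pair_feasible kc gGH).
rewrite (good_pair_value gGH) lee_fin.
have [intGH <-] := good_pair_integral gGH.
apply: le_Rintegral_spt => //; first exact: (cost_integrable lk).
move=> z sz; have : kk z - G z.1 <= H z.2.
  by apply: Hm => x _; have := Gq _ x sz; lra.
by rewrite /=; lra.
Qed.

(** The slack [w] is nonnegative on the support and its integral is at most 0, so it vanishes almost
    everywhere. By continuity the set where [w] is nonzero is open; being null, it contains no point
    of the support. *)
Lemma good_pair_eq_on_spt N f g : good_pair rho mu k C N f g ->
  \int[gamma]_z kk z <= pair_value rho mu f g ->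
  forall z, spt gamma z -> f z.1 + g z.2 = k z.1 z.2.
Proof.
move=> gfg le_int z0 sz0; have [intfg fgE] := good_pair_integral gfg.
have intk := cost_integrable lk gamma.
pose w z := kk z - (f z.1 + g z.2).
have intw : gamma.-integrable setT (EFin \o w).
  exact: (integrableB measurableT intk intfg).
have w0 z : spt gamma z -> 0 <= w z.
  move=> sz; have [Kz Lz] := coupling_spt og.1 sz.
  by case: gfg => _ _ _ _ H; rewrite subr_ge0 H.
have wle0 : \int[gamma]_z w z <= 0.
  by rewrite RintegralB// fgE subr_le0.
have intaw : gamma.-integrable setT (EFin \o (fun z => `|w z|)).
  exact: integrable_norm.
have aw0 : \int[gamma]_z `|w z| = 0.
  apply/eqP; rewrite eq_le Rintegral_ge0// andbT; apply: le_trans wle0.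
  by apply: le_Rintegral_spt => // z sz; rewrite ger0_norm ?w0.
have cw : continuous w.
  case: gfg => lf lg _ _ _ z.
  apply: cvgB; first exact: (cost_continuous lk).
  apply: cvgD.
    by apply: (continuous_comp (@cvg_fst _ _ _ _ _)); exact: lipschitz_is_continuous lf _.
  by apply: (continuous_comp (@cvg_snd _ _ _ _ _)); exact: lipschitz_is_continuous lg _.
have mw := continuous_rV2_measurable cw.
have aew : ae_eq gamma setT (EFin \o w) (cst 0%E).
  apply/ae_eq_integral_abs => //; first exact/measurable_EFinP.
  have := integrable_fin_num measurableT intaw.
  by move=> /fineK <-; rewrite -[fine _]/(\int[gamma]_z `|w z|) aw0.
apply: contrapT => fgk.
pose W := w @^-1` [set t | t != 0].
have oW : open W by apply: open_comp => [z _|]; [exact: cw|exact: open_neq].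
have Wz0 : W z0 by apply/eqP => wz0; apply: fgk; move: wz0; rewrite /w; lra.
have := sz0 _ oW Wz0; case: aew => A [mA A0 HA].
suff -> : gamma W = 0%E by rewrite ltxx.
apply: (subset_measure0 (open_rV2_measurable oW) mA) => // z Wz; apply: HA.
by move=> /= /(_ I) -[] wz; move/eqP: Wz; apply.
Qed.
End complementary_slackness.

Lemma potential_eq_of_integral (R : realType) d (nu : probability 'rV[R]_d R)
    (phi : 'rV[R]_d -> \bar R) (f : 'rV[R]_d -> R) (C N l : R) :
  potential nu phi ->
  (forall x x', `|f x - f x'| <= C * `|x - x'|) -> (forall x, `|f x| <= N) ->
  (forall x, spt nu x -> (phi x <= (f x + l)%:E)%E) ->
  ((\int[nu]_x f x + l)%:E <= \int[nu]_x phi x)%E ->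
  {ae nu, forall x, phi x = (f x + l)%:E}.
Proof.
move=> [phioo intphi] lf fN phif le_int.
have intf := bounded_lipschitz_integrable nu lf fN.
have intl : nu.-integrable setT (EFin \o cst l).
  exact: finite_measure_integrable_cst.
have nuT : fine (nu setT) = 1 by rewrite probability_setT.
have flE : \int[nu]_x f x + l = \int[nu]_x (f x + l).
  rewrite RintegralD// Rintegral_cst//; congr (_ + _).
  by rewrite -[LHS]mulr1; congr (_ * _).
have intfl : nu.-integrable setT (EFin \o (fun x => f x + l)).
  exact: (integrableD measurableT intf intl).
have mK := spt_measurable nu.
have mKC : measurable (~` spt nu) by exact: measurableC.
have K0 : nu (~` spt nu) = 0%E by exact: rV_spt_setC_null.
pose h x := ((f x + l)%:E - phi x)%E.
have inth : nu.-integrable setT h by exact: (integrableB measurableT intfl intphi).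
have h0 x : spt nu x -> (0 <= h x)%E.
  move=> Kx; rewrite /h; have := phif x Kx; have := phioo x.
  case: (phi x) => [r _ rle|//|_ _]; last by rewrite /= addey.
  by rewrite -EFinB lee_fin subr_ge0 -lee_fin.
have mh := measurable_int nu inth.
have : (\int[nu]_(x in spt nu) `|h x| = 0)%E.
  rewrite (eq_integral h); last first.
    by move=> x /set_mem Kx; rewrite gee0_abs// h0.
  apply/eqP; rewrite eq_le integral_ge0//= andbT.
  have -> : (\int[nu]_(x in spt nu) h x = \int[nu]_x h x)%E.
    by rewrite [RHS](negligible_integral mKC _ inth)// setTD setCK.
  rewrite integralB// sube_le0 -[X in (X <= _)%E]fineK.
    by rewrite -/(Rintegral nu setT (fun x => f x + l)) -flE.
  exact: integrable_fin_num.
move=> /(ae_eq_integral_abs nu mK (measurable_funTS mh)) [A [mA A0 HA]].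
exists (A `|` ~` spt nu); split; first exact: measurableU.
  by apply/eqP; rewrite measureU0//; exact/eqP.
move=> x /= H; have [Kx|] := pselect (spt nu x); last by right.
left; apply: HA => /= /(_ Kx) hx; apply: H.
move: hx; rewrite /h; have := phioo x.
case: (phi x) => //= r _; rewrite -EFinB => -[] /eqP.
by rewrite subr_eq0 => /eqP ->.
Qed.

(** * Uniqueness *)

Lemma clos_refl_trans_edge (V : Type) (adj : V -> V -> Prop) u v :
  clos_refl_trans V adj u v -> u <> v -> exists a b, adj a b.
Proof.
elim=> [a b ab _|a /(_ erefl)[]|a b e _ IHab _ IHbe ae]; first by exists a, b.
have [ab|] := pselect (a = b); last exact: IHab.
by apply: IHbe; rewrite -ab.
Qed.

Lemma rectifiably_connected_constant (R : realType) d (c : 'rV[R]_d -> 'rV[R]_d -> R)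
    (f0 f1 : 'rV[R]_d -> R) (A S : set 'rV[R]_d) (C : R) :
  (forall x y, differentiable (c^~ y) x) -> 0 <= C ->
  (forall x x', `|f0 x - f0 x'| <= C * `|x - x'|) ->
  (forall x x', `|f1 x - f1 x'| <= C * `|x - x'|) ->
  (forall x, S x -> exists y, forall x', S x' ->
     c x y - f0 x <= c x' y - f0 x' /\ c x y - f1 x <= c x' y - f1 x') ->
  rectifiably_connected A -> A `<=` S ->
  forall x x', A x -> A x' -> f0 x - f1 x = f0 x' - f1 x'.
Proof.
move=> dc C0 lf0 lf1 Smin Acon AS x x' Ax Ax'.
have [w [wAC wA w0 w1]] := Acon _ _ Ax Ax'.
have [l [h [l0 lh hw h0 h1]]] := rectifiable_reparametrization wAC.
rewrite -w0 -w1 -h0 -h1.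
apply: (curve_difference_constant dc C0 lf0 lf1 Smin l0 lh) => u.
by have [t t01 ->] := hw u; apply: AS; exact: wA.
Qed.

Lemma slack_minimizer (R : realType) (X Y : Type) (K : set X) (L : set Y)
    (k : X -> Y -> R) (f : X -> R) (g : Y -> R) x y :
  (forall x y, K x -> L y -> f x + g y <= k x y) -> L y -> f x + g y = k x y ->
  forall x', K x' -> k x y - f x <= k x' y - f x'.
Proof. by move=> fgk Ly fgE x' Kx'; have := fgk _ _ Kx' Ly; lra. Qed.

Lemma differentiable_sections (R : realType) (U V : normedModType R)
    (c : U * V -> R) : (forall z, differentiable c z) ->
  (forall x y, differentiable (fun x => c (x, y)) x) /\
  (forall y x, differentiable (fun y => c (x, y)) y).
Proof.
move=> dc; split=> [x y|y x].
  have dpair : differentiable (fun x : U => (x, y)) x.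
    apply: (@differentiable_pair _ _ _ _ (fun x => x) (cst y)).
      by have [] := is_diff_id x.
    exact: differentiable_cst.
  exact: (@differentiable_comp _ _ _ _ (fun x => (x, y)) c).
have dpair : differentiable (fun y : V => (x, y)) y.
  apply: (@differentiable_pair _ _ _ _ (cst x) (fun y => y)).
    exact: differentiable_cst.
  by have [] := is_diff_id y.
exact: (@differentiable_comp _ _ _ _ (fun y => (x, y)) c).
Qed.

Theorem theorem1p3 (R : realType) (d : nat)
    (c : 'rV[R]_d * 'rV[R]_d -> R) (rho mu : probability 'rV[R]_d R)
    (I J : Type) (A : I -> set 'rV[R]_d) (B : J -> set 'rV[R]_d)
    (c_C1 : C1 c)
    (rho_bounded : bounded_set (spt rho))
    (mu_bounded : bounded_set (spt mu))
    (A_measurable : forall i, measurable (A i))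
    (B_measurable : forall j, measurable (B j))
    (A_connected : forall i, rectifiably_connected (A i))
    (B_connected : forall j, rectifiably_connected (B j))
    (spt_rho : spt rho = \bigcup_i A i)
    (spt_mu : spt mu = \bigcup_j B j) :
  (exists phi psi, dual_optimal c rho mu phi psi) /\
  (graph_connected (ot_adj c rho mu A B) ->
   forall phi0 psi0 phi1 psi1,
     dual_optimal c rho mu phi0 psi0 -> dual_optimal c rho mu phi1 psi1 ->
     exists l : R,
       {ae rho, forall x, (phi0 x - phi1 x)%E = l%:E} /\
       {ae mu, forall y, (psi0 y - psi1 y)%E = (- l)%:E}).
Proof.
have cK := bounded_closed_compact rho_bounded (@closed_spt _ _ rho).
have cL := bounded_closed_compact mu_bounded (@closed_spt _ _ mu).
have [k [C [M [lk kc]]]] := regularized_cost c_C1 rho_bounded mu_bounded.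
have dc : forall z, differentiable c z by case: c_C1.
have [dcl dcr] := differentiable_sections dc.
have cc : continuous c by move=> z; exact: differentiable_continuous.
split.
  have [p [q [_ opt]]] := dual_optimal_exists lk kc cK cL.
  by exists (cut (spt rho) p), (cut (spt mu) q).
move=> conn phi0 psi0 phi1 psi1 opt0 opt1.
have AK i : A i `<=` spt rho by rewrite spt_rho; exact: bigcup_sup.
have BL j : B j `<=` spt mu by rewrite spt_mu; exact: bigcup_sup.
have [x0 Kx0] := spt_neq0 rho; have [y0 Ly0] := spt_neq0 mu.
have [i0 _ Ax0] : (\bigcup_i A i) x0 by rewrite -spt_rho.
have [j0 _ By0] : (\bigcup_j B j) y0 by rewrite -spt_mu.
(* The vertices [inl i0] and [inr j0] are distinct, so a path between them has an edge, and an edge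
   carries an optimal plan. *)
have [gamma og] : exists gamma, optimal_plan c rho mu gamma.
  have [//|[a|a] [[b|b]//= [g [og _]]]] :=
    clos_refl_trans_edge (conn (inl i0) (inr j0)) _; by exists g.
(* The slackness identity is obtained for every optimal plan [ga], since different edges of the
   graph may use different plans. *)
have rep phi psi : dual_optimal c rho mu phi psi -> exists f g l,
    [/\ good_pair rho mu k C (3 * M) f g,
        {ae rho, forall x, phi x = (f x + l)%:E},
        {ae mu, forall y, psi y = (g y - l)%:E} &
        forall ga, optimal_plan c rho mu ga ->
          forall z, spt ga z -> f z.1 + g z.2 = k z.1 z.2].
  move=> [feas opt].
  have [f [g [l [gfg phif psig le_v]]]] := dual_feasible_improvement lk kc feas.
  have fg_le : ((pair_value rho mu f g)%:E <= dual_value rho mu phi psi)%E.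
    by rewrite -(good_pair_value gfg); apply: opt; exact: good_pair_feasible gfg.
  have [lf lg fN gN _] := gfg; have [pphi ppsi _] := feas.
  have le_phi := potential_le_integral pphi lf fN phif.
  have le_psi := potential_le_integral ppsi lg gN psig.
  have fin_phi : (\int[rho]_x phi x)%E \is a fin_num.
    by case: pphi => _; exact: integrable_fin_num.
  have fin_psi : (\int[mu]_x psi x)%E \is a fin_num.
    by case: ppsi => _; exact: integrable_fin_num.
  (* The upper bounds [le_phi] and [le_psi] add up to the value of [(f, g)], which by optimality
     does not exceed that of [(phi, psi)]; hence neither bound can be strict. *)
  have : \int[rho]_x f x + l <= fine (\int[rho]_x phi x)%E /\
         \int[mu]_x g x - l <= fine (\int[mu]_x psi x)%E.
    move: fg_le le_phi le_psi; rewrite /dual_value /pair_value.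
    rewrite -(fineK fin_phi) -(fineK fin_psi) -EFinD !lee_fin /= => ? ? ?.
    by split; lra.
  rewrite -!lee_fin !fineK// => -[ge_phi ge_psi].
  exists f, g, l; split => //.
  - exact: potential_eq_of_integral pphi lf fN phif ge_phi.
  - exact: potential_eq_of_integral ppsi lg gN psig ge_psi.
  move=> ga oga; apply: (good_pair_eq_on_spt lk oga gfg).
  have [phi' [psi' [feas' gap]]] := no_duality_gap lk kc cc oga.
  rewrite -lee_fin; apply: le_trans gap (le_trans (opt _ _ feas') le_v).
have [f0 [g0 [l0 [gp0 phiE0 psiE0 eq0]]]] := rep _ _ opt0.
have [f1 [g1 [l1 [gp1 phiE1 psiE1 eq1]]]] := rep _ _ opt1.
have [lf0 lg0 _ _ fgk0] := gp0; have [lf1 lg1 _ _ fgk1] := gp1.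
have C0 : 0 <= C by case: lk.
have cstA i x x' : A i x -> A i x' -> f0 x - f1 x = f0 x' - f1 x'.
  apply: (rectifiably_connected_constant (c := fun x y => c (x, y)) (S := spt rho)
    dcl C0 lf0 lf1 _ (A_connected i) (AK i)).
  move=> {}x Kx; have [y sxy] := coupling_fiber_fst og.1 cK cL Kx.
  have [_ /= Ly] := coupling_spt og.1 sxy.
  exists y => {}x' Kx'; rewrite -!kc//.
  by split; [apply: (slack_minimizer fgk0) => //|apply: (slack_minimizer fgk1) => //];
    [exact: eq0 og _ sxy|exact: eq1 og _ sxy].
have cstB j y y' : B j y -> B j y' -> g0 y - g1 y = g0 y' - g1 y'.
  apply: (rectifiably_connected_constant (c := fun y x => c (x, y)) (S := spt mu)
    dcr C0 lg0 lg1 _ (B_connected j) (BL j)).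
  move=> {}y Ly; have [x sxy] := coupling_fiber_snd og.1 cK cL Ly.
  have [/= Kx _] := coupling_spt og.1 sxy.
  exists x => {}y' Ly'; rewrite -!kc//.
  have fgk0' v u : spt mu v -> spt rho u -> g0 v + f0 u <= k u v.
    by move=> ? ?; rewrite addrC; exact: fgk0.
  have fgk1' v u : spt mu v -> spt rho u -> g1 v + f1 u <= k u v.
    by move=> ? ?; rewrite addrC; exact: fgk1.
  by split; [apply: (slack_minimizer (k := fun y x => k x y) fgk0') => //|
             apply: (slack_minimizer (k := fun y x => k x y) fgk1') => //];
    rewrite addrC; [exact: eq0 og _ sxy|exact: eq1 og _ sxy].
(* An edge reverses the sign of the constant, hence [- t] on the [B] side. An empty set has every
   level, but the sets joined by an edge contain points, so the level passes on. *)
pose level (t : R) (u : I + J) := match u with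
  | inl i => forall x, A i x -> f0 x - f1 x = t
  | inr j => forall y, B j y -> g0 y - g1 y = - t end.
have edge i j : (exists gamma, optimal_plan c rho mu gamma /\
    (0 < gamma (A i `*` B j))%E) ->
    exists x y, [/\ A i x, B j y & f0 x - f1 x = - (g0 y - g1 y)].
  move=> [ga [oga ga0]].
  (* A rectangle of positive mass meets the support, whose complement is null. *)
  have [[x y] [[/= Ax By] sxy]] : exists z, (A i `*` B j) z /\ spt ga z.
    apply: contrapT => H; move: ga0; apply/negP; rewrite -leNgt.
    rewrite (subset_measure0 _ _ _ (rV2_spt_setC_null ga))//.
    - exact: measurableX.
    - by apply: measurableC; exact: rV2_spt_measurable.
    - by move=> z Az sz; apply: H; exists z.
  exists x, y; split => //.
  by have /= := eq0 _ oga _ sxy; have /= := eq1 _ oga _ sxy; lra.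
have level_step t u v : ot_adj c rho mu A B u v -> level t u -> level t v.
  case: u v => [i|j] [i'|j'] //= /edge[x [y [Ax By e]]] lev.
  - by move=> y' By'; rewrite (cstB _ _ _ By' By); have := lev _ Ax; lra.
  - by move=> x' Ax'; rewrite (cstA _ _ _ Ax' Ax); have := lev _ By; lra.
pose t := f0 x0 - f1 x0.
have level_all v : level t v.
  have : level t (inl i0) by move=> x Ax; exact: cstA Ax Ax0.
  elim: (conn (inl i0) v) => // [u w|u w z _ IH1 _ IH2 /IH1 /IH2 //].
  exact: level_step.
have tK x : spt rho x -> f0 x - f1 x = t.
  by rewrite spt_rho => -[i _ Ax]; exact: (level_all (inl i)).
have tL y : spt mu y -> g0 y - g1 y = - t.
  by rewrite spt_mu => -[j _ By]; exact: (level_all (inr j)).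
have aeF (nu : probability 'rV[R]_d R) : Filter (almost_everywhere nu).
  exact: ae_filter_ringOfSetsType.
(* Passing back from the good pairs to the given potentials adds [l0 - l1] on the [rho] side and
   subtracts it on the [mu] side. *)
exists (t + l0 - l1); split.
- apply: (@filterS3 _ _ (aeF rho) _ _ _ _ _ phiE0 phiE1 (ae_spt tK)).
  by move=> x /= -> -> e; rewrite -EFinB; congr EFin; lra.
- apply: (@filterS3 _ _ (aeF mu) _ _ _ _ _ psiE0 psiE1 (ae_spt tL)).
  by move=> y /= -> -> e; rewrite -EFinB; congr EFin; lra.
Qed.
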